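(* Consider the $L$-cell uplink system with $M$-antenna base stations and $K$ users per cell described in the context, with matched filtering used as the $M$-dimensional decoding in decentralized Large Scale Fading Decoding (LSFD). Fix a user $k$ in cell $l$ and the set $\Omega^{(l)}\subseteq\{1,\ldots,L\}$, $l\in\Omega^{(l)}$, of cells cooperating with cell $l$. Let $\tilde{\mathbf s}^{(l)}_k=(\tilde s_{kj}:j\in\Omega^{(l)})^T$ and $$\mathbf a_{kl}^{\mathrm{MMSE}}=\mathbb E\bigl[\tilde{\mathbf s}^{(l)}_k\tilde{\mathbf s}^{(l)\mathsf H}_k\bigr]^{-1}\mathbb E\bigl[\tilde{\mathbf s}^{(l)}_ks_{kl}^*\bigr].$$ Then $$\mathbf a_{kl}^{\mathrm{MMSE}}=c\cdot\mathbf D_k^{-1}\hat{\mathbf a}_{kl,\mathrm{opt,dec}}$$ for some nonzero scalar constant $c$, where $$\hat{\mathbf a}_{kl,\mathrm{opt,dec}}=\Bigl(\sum_{n=1,\,n\ne l}^L\boldsymbol\beta^{(l)}_{kn}\boldsymbol\beta^{(l)\mathsf H}_{kn}p_{kn}q_{kn}M+\boldsymbol\Lambda_k^{(l)}\Bigr)^{-1}\boldsymbol\beta^{(l)}_{kl}.$$ The vector $\mathbf a_{kl}^{\mathrm{MMSE}}$ is optimal, i.e. it maximizes $\mathrm{SINR}_{kl,\mathrm{dec}}$ over all nonzero LSFD coefficient vectors $\mathbf a_{kl,\mathrm{dec}}\in\mathbb C^{\Omega^{(l)}}$, and it leads to the optimal value $$\mathrm{SINR}_{kl,\mathrm{opt,dec}}=p_{kl}q_{kl}M\cdot\boldsymbol\beta_{kl}^{(l)\mathsf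 H}\Bigl(\sum_{n=1,\,n\ne l}^L\boldsymbol\beta^{(l)}_{kn}\boldsymbol\beta^{(l)\mathsf H}_{kn}p_{kn}q_{kn}M+\boldsymbol\Lambda_k^{(l)}\Bigr)^{-1}\boldsymbol\beta^{(l)}_{kl}.$$
   Context: Model. The channel vector from user $k$ of cell $n$ to base station $j$ is $\mathbf g_{jkn}=\sqrt{\beta_{jkn}}\,\mathbf h_{jkn}\in\mathbb C^M$, with deterministic $\beta_{jkn}>0$ and $\mathbf h_{jkn}\sim\mathcal{CN}(\mathbf 0,\mathbf I_M)$ independent over all $(j,k,n)$. Training powers $p_{kn}>0$, data powers $q_{kn}>0$. Training: base station $j$ obtains, for each $k$, $\mathbf r_{kj}=\sum_{n=1}^L\mathbf g_{jkn}\sqrt{p_{kn}}+\bar{\mathbf z}_{kj}$ with independent $\bar{\mathbf z}_{kj}\sim\mathcal{CN}(\mathbf 0,\mathbf I_M)$, independent of the channels, and forms the MMSE estimate $\hat{\mathbf g}_{jkj}=\eta_{kj}\mathbf r_{kj}$, where $$\eta_{kj}=\frac{\beta_{jkj}\sqrt{p_{kj}}}{1+\sum_{i=1}^L\beta_{jki}p_{ki}}.$$ Data: base station $j$ receives $\mathbf y_j=\sum_{n=1}^L\sum_{m=1}^K\mathbf g_{jmn}\sqrt{q_{mn}}\,s_{mn}+\mathbf z_j$, where the symbols $s_{mn}$ are independent, zero mean, $\mathbb E|s_{mn}|^2=1$, $\mathbf z_j\sim\mathcal{CN}(\mathbf 0,\mathbf I_M)$ are independent, and symbols, noises, and channels/training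 noises are mutually independent. Matched filtering gives $\tilde s_{kj}=\hat{\mathbf g}_{jkj}^{\mathsf H}\mathbf y_j$. Decentralized LSFD: base station $l$ collects $\tilde s_{kj}$ only from $j\in\Omega^{(l)}$ (cell $l$ together with its $L'$ neighboring cells) and computes $\hat s_{kl,\mathrm{dec}}=\mathbf a_{kl,\mathrm{dec}}^{\mathsf H}\tilde{\mathbf s}^{(l)}_k$ with $\mathbf a_{kl,\mathrm{dec}}=(a_{klj,\mathrm{dec}}:j\in\Omega^{(l)})$. With $\hat a_{klj,\mathrm{dec}}=\eta_{kj}a_{klj,\mathrm{dec}}$, the resulting SINR is $$\mathrm{SINR}_{kl,\mathrm{dec}}=\frac{Mp_{kl}q_{kl}\bigl|\sum_{j\in\Omega^{(l)}}\hat a_{klj,\mathrm{dec}}^*\beta_{jkl}\bigr|^2}{M\sum_{n=1,\,n\ne l}^Lp_{kn}q_{kn}\bigl|\sum_{j\in\Omega^{(l)}}\hat a_{klj,\mathrm{dec}}^*\beta_{jkn}\bigr|^2+\sum_{j\in\Omega^{(l)}}|\hat a_{klj,\mathrm{dec}}|^2\lambda_{jk}},$$ where $$\lambda_{jk}=\Bigl(1+\sum_{i=1}^L\beta_{jki}p_{ki}\Bigr)\Bigl(1+\sum_{n=1}^L\sum_{m=1}^K\beta_{jmn}q_{mn}\Bigr).$$ Further notation: $\boldsymbol\beta^{(l)}_{kn}=(\beta_{jkn}:j\in\Omega^{(l)})^T$, $\boldsymbol\Lambda^{(l)}_k=\mathrm{diag}(\lambda_{jk}:j\in\Omega^{(l)})$,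 $\mathbf D_k=\mathrm{diag}(\eta_{kj}:j\in\Omega^{(l)})$. Expectations are over symbols, channels and noises, for fixed $\beta$'s and powers; $(\cdot)^{\mathsf H}$ is Hermitian transpose and $(\cdot)^*$ complex conjugation. *)

(* Defs.v *)
From HB Require Import structures.
From mathcomp Require Import all_boot all_order all_algebra.
From mathcomp Require Import all_classical all_reals all_analysis.
From mathcomp Require Import complex.

Set Implicit Arguments.
Unset Strict Implicit.
Unset Printing Implicit Defensive.

Import Order.TTheory GRing.Theory Num.Theory.

Local Open Scope classical_set_scope.
Local Open Scope ring_scope.
Local Open Scope complex_scope.
Local Open Scope sesquilinear_scope.

Section ComplexRandomVectors.
Context (d : measure_display) (T : measurableType d) (R : realType).
Variable P : probability T R.

Definition mutually_independent (I : finType) (F : I -> set (set T)) : Prop :=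
  forall (A : I -> set T), (forall i, F i (A i)) ->
  forall J : {set I},
    P (\bigcap_(i in [set` J]) A i) = (\prod_(i in J) P (A i))%E.

(* The 2n real coordinates of a random vector of C^n: (i, false) is the real
   part of entry i and (i, true) its imaginary part. *)
Definition coordinate (n : nat) (X : T -> 'cV[R[i]]_n) (ib : 'I_n * bool)
    (t : T) : R :=
  if ib.2 then complex.Im (X t ib.1 0) else complex.Re (X t ib.1 0).

Definition complex_random_vector (n : nat) (X : T -> 'cV[R[i]]_n) : Prop :=
  forall ib, measurable_fun setT (coordinate X ib).

Definition sigma_of (n : nat) (X : T -> 'cV[R[i]]_n) : set (set T) :=
  <<s \bigcup_ib preimage_set_system setT (coordinate X ib) measurable >>.

(* X ~ CN(0, I_n), circularly symmetric: the real and imaginary parts of the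
   entries are i.i.d. N(0, 1/2), so that each entry has E|X_i|^2 = 1 (the
   second parameter of normal_prob is a standard deviation). *)
Definition standard_complex_normal (n : nat) (X : T -> 'cV[R[i]]_n) : Prop :=
  [/\ complex_random_vector X,
      forall ib (A : set R), measurable A ->
        P (coordinate X ib @^-1` A) = normal_prob 0 (Num.sqrt 2^-1) A &
      mutually_independent
        (fun ib => preimage_set_system setT (coordinate X ib) measurable)].

Definition cexpectation (X : T -> R[i]) : R[i] :=
  fine 'E_P[fun t => complex.Re (X t)]%E +i*
  fine 'E_P[fun t => complex.Im (X t)]%E.

Definition mxexpectation (m n : nat) (X : T -> 'M[R[i]]_(m, n)) :
    'M[R[i]]_(m, n) :=
  \matrix_(i, j) cexpectation (fun t => X t i j).

End ComplexRandomVectors.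

(* Base stations and cells are 'I_L and users in a cell are 'I_K.
   beta j k n and h j k n belong to the link from user k of cell n to base
   station j; p k n, q k n and s k n belong to user k of cell n; zbar k j is
   the noise in the estimation of user k at base station j. *)
Section Uplink.
Context (d : measure_display) (T : measurableType d) (R : realType).
Variables (P : probability T R) (L K M : nat).
Variables (beta : 'I_L -> 'I_K -> 'I_L -> R) (p q : 'I_K -> 'I_L -> R).
Variables (h : 'I_L -> 'I_K -> 'I_L -> T -> 'cV[R[i]]_M)
          (zbar : 'I_K -> 'I_L -> T -> 'cV[R[i]]_M)
          (s : 'I_K -> 'I_L -> T -> R[i])
          (z : 'I_L -> T -> 'cV[R[i]]_M).

Definition symbol_vector (m : 'I_K) (n : 'I_L) (t : T) : 'cV[R[i]]_1 :=
  (s m n t)%:M.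

(* In order: fading vectors, training noises, symbols, data noises. *)
Definition source_sigma
    (x : 'I_L * 'I_K * 'I_L + 'I_K * 'I_L + 'I_K * 'I_L + 'I_L) :
    set (set T) :=
  match x with
  | inl (inl (inl (j, k, n))) => sigma_of (h j k n)
  | inl (inl (inr (k, j))) => sigma_of (zbar k j)
  | inl (inr (m, n)) => sigma_of (symbol_vector m n)
  | inr j => sigma_of (z j)
  end.

Record uplink_model : Prop := {
  fading_normal : forall j k n, standard_complex_normal P (h j k n);
  training_noise_normal : forall k j, standard_complex_normal P (zbar k j);
  data_noise_normal : forall j, standard_complex_normal P (z j);
  symbol_measurable : forall m n, complex_random_vector (symbol_vector m n);
  symbol_mean : forall m n, cexpectation P (s m n) = 0;
  symbol_power : forall m n,
    ('E_P[fun t => (Normc.normc (s m n t) ^+ 2)%R] = 1)%E;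
  sources_independent : mutually_independent P source_sigma
}.

Definition channel j k n (t : T) : 'cV[R[i]]_M :=
  (Num.sqrt (beta j k n))%:C *: h j k n t.

Definition training_signal k j (t : T) : 'cV[R[i]]_M :=
  \sum_n (Num.sqrt (p k n))%:C *: channel j k n t + zbar k j t.

Definition eta k j : R :=
  beta j k j * Num.sqrt (p k j) / (1 + \sum_i beta j k i * p k i).

Definition channel_estimate j k (t : T) : 'cV[R[i]]_M :=
  (eta k j)%:C *: training_signal k j t.

Definition received j (t : T) : 'cV[R[i]]_M :=
  \sum_n \sum_m ((Num.sqrt (q m n))%:C * s m n t) *: channel j m n t + z j t.

Definition matched_filter k j (t : T) : R[i] :=
  ((channel_estimate j k t)^t* *m received j t) 0 0.

Definition lambda j k : R :=
  (1 + \sum_i beta j k i * p k i) *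
  (1 + \sum_n \sum_m beta j m n * q m n).

(* Vectors of C^Omega are indexed by 'I_#|Omega|, the i-th entry being that of
   the cell enum_val i. *)
Variable Omega : {set 'I_L}.

Definition mf_vector k (t : T) : 'cV[R[i]]_#|Omega| :=
  \col_i matched_filter k (enum_val i) t.

Definition mf_covariance k : 'M[R[i]]_#|Omega| :=
  mxexpectation P (fun t => mf_vector k t *m (mf_vector k t)^t*).

Definition a_MMSE k l : 'cV[R[i]]_#|Omega| :=
  invmx (mf_covariance k) *m
  mxexpectation P (fun t => (s k l t)^*%R *: mf_vector k t).

Definition beta_vector k n : 'cV[R[i]]_#|Omega| :=
  \col_i (beta (enum_val i) k n)%:C.

Definition Lambda_mx k : 'M[R[i]]_#|Omega| :=
  diag_mx (\row_i (lambda (enum_val i) k)%:C).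

Definition D_mx k : 'M[R[i]]_#|Omega| :=
  diag_mx (\row_i (eta k (enum_val i))%:C).

Definition interference_mx k l : 'M[R[i]]_#|Omega| :=
  \sum_(n | n != l) (p k n * q k n * M%:R)%:C *:
     (beta_vector k n *m (beta_vector k n)^t*)
  + Lambda_mx k.

Definition ahat_opt k l : 'cV[R[i]]_#|Omega| :=
  invmx (interference_mx k l) *m beta_vector k l.

Definition SINR_dec k l (a : 'cV[R[i]]_#|Omega|) : R :=
  let ahat i := (eta k (enum_val i))%:C * a i 0 in
  let gain n := \sum_i (ahat i)^*%R * (beta (enum_val i) k n)%:C in
  M%:R * p k l * q k l * Normc.normc (gain l) ^+ 2 /
  (M%:R * (\sum_(n | n != l) p k n * q k n * Normc.normc (gain n) ^+ 2) +
   \sum_i Normc.normc (ahat i) ^+ 2 * lambda (enum_val i) k).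

End Uplink.

(* Main.v *)
Require Import Defs.
From HB Require Import structures.
From mathcomp Require Import all_boot all_order all_algebra.
From mathcomp Require Import all_classical all_reals all_analysis.
From mathcomp Require Import complex.
From mathcomp Require Import measurable_realfun finmap ring lra zify.

Set Implicit Arguments.
Unset Strict Implicit.
Unset Printing Implicit Defensive.

Import Order.TTheory GRing.Theory Num.Theory.

Local Open Scope ring_scope.
Local Open Scope complex_scope.
Local Open Scope sesquilinear_scope.

(** Write the matched-filter output as a linear combination of monomials
    [sigma * conj x_u * x_v], where [sigma] is a data symbol (or 1 for the data
    noise) and [x_u], [x_v] are entries of independent standard complex normal
    vectors.  The fourth-order Wick formula
      [E (conj x1 * x2 * x3 * conj x4) = [x1 = x2][x3 = x4] + [x1 = x3][x2 = x4]]
    and the whiteness of the symbols give the covariance matrix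
    [M D (A + w b b^H) D] with [w = M p_kl q_kl], and the correlation with [s_kl]
    is [M sqrt(p_kl q_kl) D b].  As [(A + w b b^H) A^-1 b] is a multiple of [b],
    the MMSE vector is a multiple of [D^-1 A^-1 b].  The SINR of [a] is the
    Rayleigh quotient [w |v^H b|^2 / v^H A v] at [v = D a], maximal at
    [v = A^-1 b] by the Cauchy-Schwarz inequality for the inner product of [A]. *)

(** * Integration against weighted image measures *)

(** The model gives independence only as a product rule for probabilities of events, whereas
    expectations of unbounded complex monomials are needed. For nonnegative functions the passage
    compares two weighted image measures, one factor after the other. For complex functions both
    sides of the product rule are linear in each factor, so the rule extends to linear spans. This
    extension serves twice: to reach complex functions from their nonnegative parts, and to reach
    powers of a complex entry and its conjugate from real monomials.

    The two Wick pairings play different roles in the covariance. Pairing the estimate with the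
    received signal inside each filter leaves both antenna indices free and gives M^2 times the
    pilot contamination. Pairing across the two filters forces equal antennas, and the sum splits
    into training energy times received energy: M times [lambda], on the diagonal only. The gap of
    one factor M explains why M multiplies only the rank-one terms of A. *)

Lemma subr_max0 (R : realDomainType) (x : R) :
  Num.max x 0 - Num.max (- x) 0 = x.
Proof.
have [x0|x0] := leP 0 x; first by rewrite max_r ?oppr_le0 // subr0.
by rewrite max_l ?oppr_ge0 ?(ltW x0) // sub0r opprK.
Qed.

Section WeightedImage.
Context d (Y : measurableType d) (R : realType).

Import HBNNSimple.

Let ge0_integral_weighted_nnsfun d' (T : measurableType d')
    (m : {measure set T -> \bar R}) (X : T -> Y) (g : T -> R)
    (f : {nnsfun Y >-> R}) :
  measurable_fun setT X -> measurable_fun setT g -> (forall x, 0 <= g x) ->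
  let s := fset_set (range f) in
  (\int[m]_x (f (X x) * g x)%:E =
   \sum_(i < #|` s|)
     (s`_i)%:E * \int[m]_x (\1_(f @^-1` [set s`_i]) (X x) * g x)%:E)%E.
Proof.
move=> mX mg g0 s.
have s0 (i : 'I_#|` s|) : 0 <= s`_i.
  have : s`_i \in s by rewrite mem_nth.
  rewrite in_fset_set; last exact: fimfunP.
  by move=> /set_mem[y _ <-]; exact: fun_ge0.
have mi r : measurable_fun setT (fun x => \1_(f @^-1` [set r]) (X x) * g x).
  apply: measurable_funM => //.
  by apply: (measurableT_comp _ mX); exact: measurable_indic.
have i0 r x : 0 <= \1_(f @^-1` [set r]) (X x) * g x.
  by rewrite mulr_ge0 // indicE.
under eq_integral => x _.
  rewrite fimfunEord mulr_suml -sumEFin.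
  under eq_bigr => i _ do rewrite -mulrA EFinM.
  over.
rewrite ge0_integral_sum //.
- apply: eq_bigr => i _; rewrite ge0_integralZl //.
  + by apply/measurable_EFinP; exact: mi.
  + by move=> x _; rewrite lee_fin.
  + by rewrite lee_fin s0.
- by move=> i; apply/measurable_EFinP; apply: measurable_funM => //; exact: mi.
- by move=> i x _; rewrite -EFinM lee_fin mulr_ge0.
Qed.

Context d1 d2 (T1 : measurableType d1) (T2 : measurableType d2).
Variables (m1 : {measure set T1 -> \bar R}) (m2 : {measure set T2 -> \bar R}).
Variables (X1 : T1 -> Y) (X2 : T2 -> Y) (g1 : T1 -> R) (g2 : T2 -> R).
Hypotheses (mX1 : measurable_fun setT X1) (mX2 : measurable_fun setT X2)
  (mg1 : measurable_fun setT g1) (mg2 : measurable_fun setT g2)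
  (g1_ge0 : forall x, 0 <= g1 x) (g2_ge0 : forall x, 0 <= g2 x).

(** Indicators, then simple functions, then monotone limits. The two sides may live on different
    spaces: one use transports a law to its density on the line, another replaces a random weight by
    a constant on the same space. *)
Lemma eq_ge0_integral_weighted (f : Y -> R) :
  measurable_fun setT f -> (forall y, 0 <= f y) ->
  (forall B : set Y, measurable B ->
    \int[m1]_x (\1_B (X1 x) * g1 x)%:E = \int[m2]_x (\1_B (X2 x) * g2 x)%:E)%E ->
  (\int[m1]_x (f (X1 x) * g1 x)%:E = \int[m2]_x (f (X2 x) * g2 x)%:E)%E.
Proof.
move=> mf f0 m12.
have mEf : measurable_fun setT (EFin \o f) by exact/measurable_EFinP.
pose fn := nnsfun_approx measurableT mEf.
have key d' (T : measurableType d') (m : {measure set T -> \bar R})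
    (X : T -> Y) (g : T -> R) : measurable_fun setT X ->
    measurable_fun setT g -> (forall x, 0 <= g x) ->
    (\int[m]_x (f (X x) * g x)%:E =
     limn (fun n => \int[m]_x (fn n (X x) * g x)%:E))%E.
  move=> mX mg g0.
  rewrite -monotone_convergence //.
  - apply: eq_integral => x _; apply/esym/cvg_lim => //.
    under eq_fun do rewrite EFinM; rewrite EFinM.
    apply: cvgeZr => //.
    by apply: (@cvg_nnsfun_approx _ _ _ _ measurableT _ mEf) => // y _; rewrite lee_fin.
  - move=> n; apply/measurable_EFinP; apply: measurable_funM => //.
    exact: measurableT_comp.
  - by move=> n x _; rewrite lee_fin mulr_ge0.
  - move=> x _ n p np; rewrite lee_fin ler_wpM2r //.
    by have /lefP := @nd_nnsfun_approx _ _ _ _ measurableT _ mEf n p np; exact.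
rewrite key // [RHS]key //; congr (limn _); apply/funext => n.
rewrite !ge0_integral_weighted_nnsfun //; apply: eq_bigr => i _.
by rewrite m12 // -[X in measurable X]setTI; exact: measurable_funP.
Qed.

End WeightedImage.

Section WeightedImageIntegrable.
Context d (Y : measurableType d) (R : realType).
Context d1 d2 (T1 : measurableType d1) (T2 : measurableType d2).
Variables (m1 : {measure set T1 -> \bar R}) (m2 : {measure set T2 -> \bar R}).
Variables (X1 : T1 -> Y) (X2 : T2 -> Y) (g1 : T1 -> R) (g2 : T2 -> R).
Hypotheses (mX1 : measurable_fun setT X1) (mX2 : measurable_fun setT X2)
  (mg1 : measurable_fun setT g1) (mg2 : measurable_fun setT g2)
  (g1_ge0 : forall x, 0 <= g1 x) (g2_ge0 : forall x, 0 <= g2 x).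
Hypothesis m12 : forall B : set Y, measurable B ->
  (\int[m1]_x (\1_B (X1 x) * g1 x)%:E = \int[m2]_x (\1_B (X2 x) * g2 x)%:E)%E.

(** The nonnegative case, applied to the absolute value of [f], shows that both sides have the same
    absolute integral. *)
Lemma integrable_weighted (f : Y -> R) : measurable_fun setT f ->
  m2.-integrable setT (fun x => (f (X2 x) * g2 x)%:E) ->
  m1.-integrable setT (fun x => (f (X1 x) * g1 x)%:E).
Proof.
move=> mf /integrableP[_ fi]; apply/integrableP; split.
  by apply/measurable_EFinP; apply: measurable_funM => //; exact: measurableT_comp.
apply: le_lt_trans fi; rewrite le_eqVlt; apply/orP; left; apply/eqP.
transitivity (\int[m1]_x (`|f (X1 x)| * g1 x)%:E)%E.
  by apply: eq_integral => x _ /=; rewrite normrM (ger0_norm (g1_ge0 _)).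
rewrite (eq_ge0_integral_weighted mX1 mX2 mg1 mg2 g1_ge0 g2_ge0
  (f := fun y => `|f y|) _ _ m12) //; last exact: measurableT_comp.
by apply: eq_integral => x _ /=; rewrite normrM (ger0_norm (g2_ge0 _)).
Qed.

Lemma eq_integral_weighted (f : Y -> R) : measurable_fun setT f ->
  m2.-integrable setT (fun x => (f (X2 x) * g2 x)%:E) ->
  (\int[m1]_x (f (X1 x) * g1 x)%:E = \int[m2]_x (f (X2 x) * g2 x)%:E)%E.
Proof.
move=> mf fi; have fi1 := integrable_weighted mf fi.
pose pos (x : R) := Num.max x 0.
have pos0 x : 0 <= pos x by rewrite le_max lexx orbT.
have mpos : measurable_fun setT (fun y => pos (f y)).
  exact: measurable_maxr.
have mneg : measurable_fun setT (fun y => pos (- f y)).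
  by apply: measurable_maxr => //; exact: measurableT_comp.
have posB (x : R) : x = pos x - pos (- x) by rewrite subr_max0.
have split_int d' (T : measurableType d') (m : {measure set T -> \bar R})
    (X : T -> Y) (g : T -> R) : measurable_fun setT X -> measurable_fun setT g ->
    (forall x, 0 <= g x) -> m.-integrable setT (fun x => (f (X x) * g x)%:E) ->
    (\int[m]_x (f (X x) * g x)%:E = \int[m]_x (pos (f (X x)) * g x)%:E -
      \int[m]_x (pos (- f (X x)) * g x)%:E)%E.
  move=> mX mg g0 fgi.
  (* Any [h] dominated by the identity preserves integrability; this serves for the positive and for
     the negative part of [f]. *)
  have bound (h : R -> R) : measurable_fun setT (fun y => h (f y)) ->
      (forall x, `|h x| <= `|x|) ->
      m.-integrable setT (EFin \o (fun x => h (f (X x)) * g x)).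
    move=> mh hle; apply: le_integrable fgi => //.
      apply/measurable_EFinP; apply: measurable_funM => //.
      exact: (measurableT_comp mh).
    by move=> x _; rewrite lee_fin !normrM ler_wpM2r.
  rewrite -integralB_EFin //.
  - apply: eq_integral => x _; rewrite [in LHS](posB (f (X x))) mulrBl.
    by rewrite EFinB.
  - apply: bound => // x; rewrite ger0_norm //.
    by rewrite /pos; have [//|x0] := leP x 0; rewrite ler_norm.
  - apply: (bound (fun x => pos (- x))) => // x; rewrite ger0_norm //.
    by rewrite /pos -normrN; have [//|x0] := leP (- x) 0; rewrite ler_norm.
rewrite split_int // [RHS]split_int //.
rewrite (eq_ge0_integral_weighted mX1 mX2 mg1 mg2 g1_ge0 g2_ge0 
  (f := fun y => pos (f y)) _ _ m12) //.
by rewrite (eq_ge0_integral_weighted mX1 mX2 mg1 mg2 g1_ge0 g2_ge0 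
  (f := fun y => pos (- f y)) _ _ m12).
Qed.

End WeightedImageIntegrable.

(** * Gaussian moments *)

Section GaussMoments.
Import numFieldNormedType.Exports.
Context {R : realType}.
Notation mu := (@lebesgue_measure R).
Local Open Scope classical_set_scope.

(** As [gauss_fun] is the square of exp(- x^2 / 2), one factor absorbs the power of x and the other
    remains as the integrable bound. *)
Lemma gauss_moment_le (k : nat) : exists2 C : R, 0 <= C &
  forall x, `|x ^+ k * gauss_fun x| <= C * normal_fun 0 1 x.
Proof.
(* With y = x^2 / 2, C times 1 + y^(k+1) / (k+1)! equals C + |x|^(2k+2). This is at least |x|^k: by
   C >= 1 when |x| <= 1, by the larger exponent otherwise. *)
pose C : R := 2 ^+ k.+1 * (k.+1)`!%:R.
have C1 : 1 <= C.
  by rewrite /C -natrX -natrM ler1n muln_gt0 expn_gt0 fact_gt0.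
exists C => [|x]; first exact: (le_trans ler01 C1).
have -> : normal_fun 0 1 x = expR (- (x ^+ 2 / 2)).
  by rewrite /normal_fun subr0 expr1n mulNr.
have -> : gauss_fun x = expR (- (x ^+ 2 / 2)) * expR (- (x ^+ 2 / 2)).
  by rewrite -expRD /gauss_fun; congr expR; field.
rewrite mulrA normrM (ger0_norm (expR_ge0 _)) ler_wpM2r ?expR_ge0 //.
rewrite normrM (ger0_norm (expR_ge0 _)) expRN ler_pdivrMr ?expR_gt0 //.
have y0 : 0 <= x ^+ 2 / 2 by rewrite divr_ge0 ?sqr_ge0.
have := expR_ge1Dxn k y0; rewrite -(ler_pM2l (lt_le_trans ltr01 C1)).
apply: le_trans; rewrite mulrDr mulr1 expr_div_n /C mulrA normrX.
have -> : 2 ^+ k.+1 * (k.+1)`!%:R * ((x ^+ 2) ^+ k.+1 / 2 ^+ k.+1) / (k.+1)`!%:R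
    = (`|x| ^+ 2) ^+ k.+1.
  rewrite real_normK ?num_real //.
  field; rewrite pnatr_eq0 -lt0n fact_gt0 /=.
  by rewrite expf_neq0 // pnatr_eq0.
have [x1|x1] := leP `|x| 1.
  by rewrite (le_trans (exprn_ile1 _ _ x1)) // ler_wpDr ?exprn_ge0.
rewrite -exprM -[leLHS]add0r lerD //.
by apply: ler_weXn2l; [exact: ltW|lia].
Qed.

Lemma integrable_gauss_moment (k : nat) :
  mu.-integrable setT (fun x => (x ^+ k * gauss_fun x)%:E).
Proof.
have [C C0 hC] := gauss_moment_le k.
have iN : mu.-integrable setT (fun x => (C * normal_fun 0 1 x)%:E).
  have -> : (fun x => (C * normal_fun 0 1 x)%:E) = (fun x =>
      (C / normal_peak 1)%:E * (normal_pdf 0 1 x)%:E)%E :> (R -> \bar R).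
    apply/funext => x; rewrite normal_pdfE ?oner_eq0 // -EFinM; congr EFin.
    by rewrite mulrA divfK // gt_eqF // normal_peak_gt0 ?oner_eq0.
  by apply: integrableZl => //; exact: integrable_normal_pdf.
apply: le_integrable iN => //.
  apply/measurable_EFinP/measurable_funM; last exact: measurable_gauss_fun.
  exact: measurable_funX.
move=> x _; rewrite lee_fin; apply: le_trans (hC x) _; exact: ler_norm.
Qed.

(** The integral of this derivative over the line vanishes, which is the moment recursion. For
    [k = 0] the truncated [k.-1] is harmless, its coefficient being 0. *)
Lemma is_derive_gauss_moment (k : nat) (x : R) :
  is_derive x 1 (fun x => x ^+ k * gauss_fun x)
    (k%:R * (x ^+ k.-1 * gauss_fun x) - 2 * (x ^+ k.+1 * gauss_fun x)).
Proof.
have h1 : is_derive x 1 (fun x : R => x ^+ k) (k%:R * x ^+ k.-1).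
  have -> : (fun x : R => x ^+ k) = id ^+ k by apply/funext => y; rewrite exprfctE.
  by apply: is_derive_eq; rewrite /GRing.scale /= mulr1.
have h2 : is_derive x 1 (@gauss_fun R) (- (2 * x) * gauss_fun x).
  have h3 : is_derive x 1 (fun x : R => - x ^+ 2) (- (2 * x)).
    have -> : (fun x : R => - x ^+ 2) = - (id ^+ 2).
      by apply/funext => y; rewrite opprfctE exprfctE.
    by apply: is_derive_eq; rewrite /GRing.scale /= mulr1.
  by apply: is_derive_eq; rewrite /GRing.scale /= mulrC.
apply: is_derive_eq; rewrite /GRing.scale /= exprS; ring.
Qed.

Lemma continuous_gauss_moment (k : nat) :
  continuous (fun x : R => x ^+ k * gauss_fun x).
Proof.
move=> x; apply: differentiable_continuous; apply/derivable1_diffP.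
by have [] := is_derive_gauss_moment k x.
Qed.

(** Stated along sequences so as to cover both ends n and -n. Spending one more power of x in the
    Gaussian bound gives a decay in 1 / n. *)
Lemma cvg_gauss_moment (k : nat) (u : R^nat) :
  (forall n, n%:R <= `|u n|) ->
  u n ^+ k * gauss_fun (u n) @[n --> \oo] --> (0 : R).
Proof.
move=> hu; have [C C0 hC] := gauss_moment_le k.+1.
have peak1 x : normal_fun 0 1 x <= 1 :> R.
  rewrite /normal_fun -[leRHS]expR0 ler_expR mulNr oppr_le0.
  by rewrite mulr_ge0 ?sqr_ge0 ?invr_ge0 // mulrn_wge0 // sqr_ge0.
have hb n : `|u n.+1 ^+ k * gauss_fun (u n.+1)| <= C * n.+1%:R^-1.
  rewrite ler_pdivlMr ?ltr0Sn //.
  have := hC (u n.+1); rewrite exprSr mulrAC normrM => h.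
  apply: le_trans (_ : C * normal_fun 0 1 (u n.+1) <= _); last first.
    by rewrite ler_piMr.
  by apply: le_trans h; rewrite ler_wpM2l.
rewrite -(cvg_shiftS (fun n => u n ^+ k * gauss_fun (u n))).
apply/norm_cvg0P.
have h0 : C * n.+1%:R^-1 @[n --> \oo] --> (0 : R).
  rewrite -[X in _ --> X](mulr0 C); apply: cvgMl_tmp.
  exact: cvg_harmonic.
apply: (squeeze_cvgr _ (cvg_cst 0) h0).
by apply: nearW => n; rewrite normr_ge0 hb.
Qed.

(** Dominated convergence: at each point the truncations of [f] are eventually constant, and |f|
    dominates them. *)
Lemma cvg_integral_centered_segment (f : R -> R) :
  mu.-integrable setT (EFin \o f) ->
  (\int[mu]_(x in `[(- n%:R)%R, (n%:R)%R]) (f x)%:E)%E @[n --> \oo] -->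
    (\int[mu]_x (f x)%:E)%E.
Proof.
move=> fi.
pose fn (n : nat) : R -> \bar R := (EFin \o f) \_ `[- (n%:R : R), n%:R].
have mf : measurable_fun setT (EFin \o f) by exact: measurable_int fi.
have := @dominated_convergence _ _ R mu setT measurableT fn (EFin \o f)
  (abse \o (EFin \o f)).
case=> //.
- move=> n; apply/(measurable_restrictT _ _).1 => //.
  exact: measurable_funTS.
- apply: aeW => x _; apply: cvg_near_cst.
  apply: filterS (nbhs_infty_ger (`|x| : R)) => n xn.
  by rewrite /fn patchE mem_set //= in_itv /= -ler_norml.
- exact: integrable_abse.
- apply: aeW => x n _; rewrite /fn patchE /=.
  by case: ifP => // _; rewrite abse0.
move=> _ _; rewrite /fn.
by under eq_fun do rewrite -integral_mkcond.
Qed.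

Lemma Rintegral_gauss_moment_rec (k : nat) :
  2 * \int[mu]_x (x ^+ k.+1 * gauss_fun x) =
  k%:R * \int[mu]_x (x ^+ k.-1 * gauss_fun x).
Proof.
pose f (x : R) := k%:R * (x ^+ k.-1 * gauss_fun x) - 2 * (x ^+ k.+1 * gauss_fun x).
pose F (x : R) := x ^+ k * gauss_fun x.
have dF (x : R) : is_derive x 1 F (f x) := is_derive_gauss_moment k x.
have i1 := integrable_gauss_moment k.-1.
have i2 := integrable_gauss_moment k.+1.
have j1 : mu.-integrable setT (EFin \o (fun x => k%:R * (x ^+ k.-1 * gauss_fun x))).
  exact: integrableZl i1.
have j2 : mu.-integrable setT (EFin \o (fun x => 2 * (x ^+ k.+1 * gauss_fun x))).
  exact: integrableZl i2.
have fi : mu.-integrable setT (EFin \o f) by exact: integrableB j1 j2.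
have cf : continuous f.
  by move=> x; apply: cvgB; apply: cvgMl_tmp; exact: continuous_gauss_moment.
have cF : continuous F by exact: continuous_gauss_moment.
(* The endpoints use n + 1 because the fundamental theorem of calculus is applied on a nondegenerate
   segment. *)
have int_f n : (\int[mu]_(x in `[(- n.+1%:R)%R, (n.+1%:R)%R]) (f x)%:E)%E =
    (F n.+1%:R - F (- n.+1%:R))%:E.
  rewrite (@continuous_FTC2 R f F) ?EFinB //.
  - by rewrite -subr_gt0 opprK -natrD ltr0n.
  - exact: continuous_subspaceT.
  - split; first by move=> x _; have [] := dF x.
    + exact/cvg_at_right_filter/cF.
    + exact/cvg_at_left_filter/cF.
  - by move=> x _; rewrite derive1E; have [_] := dF x.
have := cvg_integral_centered_segment fi.
rewrite -(cvg_shiftS (fun n => \int[mu]_(x in `[(- n%:R)%R, (n%:R)%R]) (f x)%:E)%E).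
under eq_fun do rewrite int_f.
have lim0 : (F n.+1%:R - F (- n.+1%:R))%:E @[n --> \oo] --> (0%:E : \bar R).
  apply: cvg_EFin; first by apply: nearW.
  rewrite -[X in _ --> X](subr0 (0 : R)).
  by apply: cvgB; apply: (@cvg_gauss_moment k (fun n => _)) => n /=;
    rewrite ?normrN normr_nat ler_nat.
move=> /(cvg_unique _ lim0) /esym.
have -> : (\int[mu]_x (f x)%:E)%E = (\int[mu]_x f x)%R%:E.
  by rewrite /Rintegral fineK // integrable_fin_num.
move=> /(_ (@ereal_hausdorff R))[]; rewrite RintegralB // !RintegralZl // => /eqP.
by rewrite subr_eq0 => /eqP.
Qed.
End GaussMoments.

(** * Moments of the centered normal law of variance 1/2 *)

Section NormalMoments.
Context d (T : measurableType d) (R : realType) (P : probability T R).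
Notation mu := (@lebesgue_measure R).

(* The density of N(0, 1/2) is [gauss_fun / sqrt pi]. *)
Definition normal_moment (k : nat) : R :=
  (Num.sqrt pi)^-1 * \int[mu]_x (x ^+ k * gauss_fun x).

Lemma normal_momentS (k : nat) :
  normal_moment k.+1 = k%:R / 2 * normal_moment k.-1.
Proof.
have h := @Rintegral_gauss_moment_rec R k.
rewrite /normal_moment; apply: (@mulfI _ 2); first by rewrite pnatr_eq0.
by rewrite mulrCA h; field; rewrite sqrtr_eq0 -ltNge pi_gt0.
Qed.

Lemma normal_momentE : [/\ normal_moment 0 = 1, normal_moment 1 = 0,
  normal_moment 2 = 2^-1, normal_moment 3 = 0 & normal_moment 4 = 3 / 4].
Proof.
have m0 : normal_moment 0 = 1.
  rewrite /normal_moment /Rintegral.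
  under eq_integral do rewrite expr0 mul1r.
  by rewrite integralT_gauss /= mulVf // sqrtr_eq0 -ltNge pi_gt0.
have m1 : normal_moment 1 = 0 by rewrite normal_momentS mul0r mul0r.
have m2 : normal_moment 2 = 2^-1 by rewrite normal_momentS /= m0 mulr1 mul1r.
split=> //; first by rewrite normal_momentS /= m1 mulr0.
by rewrite normal_momentS /= m2; field.
Qed.

Variable U : T -> R.
Hypotheses (mU : measurable_fun setT U)
  (lawU : forall A, measurable A -> P (U @^-1` A)%classic =
    normal_prob 0 (Num.sqrt 2^-1) A).

Lemma normal_moment_integral (k : nat) :
  P.-integrable setT (EFin \o (fun t => U t ^+ k)) /\
  \int[P]_t (U t ^+ k) = normal_moment k.
Proof.
have s0 : Num.sqrt 2^-1 != 0 :> R by rewrite gt_eqF // sqrtr_gt0 invr_gt0.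
have pdfE x : normal_pdf 0 (Num.sqrt 2^-1) x = (Num.sqrt pi)^-1 * gauss_fun x :> R.
  rewrite normal_pdfE // /normal_peak /normal_fun /gauss_fun subr0.
  rewrite sqr_sqrtr ?invr_ge0 // -[_ *+ 2]mulr_natr mulrAC mulVf // mul1r.
  by rewrite -[_ *+ 2]mulr_natr mulVf // divr1.
pose g2 (x : R) := normal_pdf 0 (Num.sqrt 2^-1) x.
have mg2 : measurable_fun setT g2 by exact: measurable_normal_pdf.
have g20 x : 0 <= g2 x by exact: normal_pdf_ge0.
(* The law of [U] written as two weighted image measures: weight 1 on the probability space, the
   density on the line. *)
have m12 (B : set R) : measurable B ->
    (\int[P]_x (\1_B (U x) * cst 1 x)%:E = \int[mu]_x (\1_B (idfun x) * g2 x)%:E)%E.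
  move=> mB.
  have mUB : measurable (U @^-1` B)%classic by rewrite -[X in measurable X]setTI; exact: mU.
  transitivity (P (U @^-1` B)%classic).
    rewrite -[X in P X]setIT -integral_indic //.
    by apply: eq_integral => t _; rewrite mulr1.
  rewrite lawU // /normal_prob integral_mkcond; apply: eq_integral => x _.
  rewrite patchE indicE /=; case: ifP => _; first by rewrite mul1r.
  by rewrite mul0r.
have mX : measurable_fun setT (fun x : R => x ^+ k) by exact: measurable_funX.
have gi := @integrable_gauss_moment R k.
have i2 : mu.-integrable setT (fun x => ((idfun x) ^+ k * g2 x)%:E).
  have -> : (fun x => ((idfun x) ^+ k * g2 x)%:E) = (fun x =>
      ((Num.sqrt pi)^-1)%:E * (x ^+ k * gauss_fun x)%:E)%E.
    by apply/funext => x; rewrite /g2 pdfE /= mulrCA EFinM.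
  exact: integrableZl.
have m1 : measurable_fun setT (cst 1 : T -> R) by exact: measurable_cst.
have mid : measurable_fun setT (idfun : R -> R) by exact: measurable_id.
have h01 (t : T) : 0 <= cst 1 t :> R by [].
split.
  have := integrable_weighted (m2 := mu) mU mid m1 mg2 h01 g20 m12 mX i2.
  by apply: eq_integrable => // t _; rewrite mulr1.
have := eq_integral_weighted (m2 := mu) mU mid m1 mg2 h01 g20 m12 mX i2.
rewrite /normal_moment -RintegralZl // /Rintegral => h; congr fine.
transitivity (\int[P]_x (U x ^+ k * cst 1 x)%:E)%E.
  by apply: eq_integral => t _; rewrite mulr1.
by rewrite h; apply: eq_integral => x _; rewrite /g2 pdfE /= mulrCA.
Qed.

End NormalMoments.

(** * Complex expectation and independence *)

Section ComplexExpectation.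
Context d (T : measurableType d) (R : realType).
Local Notation C := R[i].

Definition cmeasurable (X : T -> C) : Prop :=
  measurable_fun setT (fun t => complex.Re (X t)) /\
  measurable_fun setT (fun t => complex.Im (X t)).

Lemma ReM (x y : C) : complex.Re (x * y) =
  complex.Re x * complex.Re y - complex.Im x * complex.Im y.
Proof. by case: x y => [a b] [c e]. Qed.

Lemma ImM (x y : C) : complex.Im (x * y) =
  complex.Re x * complex.Im y + complex.Im x * complex.Re y.
Proof. by case: x y => [a b] [c e]. Qed.

Lemma ReD (x y : C) : complex.Re (x + y) = complex.Re x + complex.Re y.
Proof. by case: x y => [a b] [c e]. Qed.

Lemma ImD (x y : C) : complex.Im (x + y) = complex.Im x + complex.Im y.
Proof. by case: x y => [a b] [c e]. Qed.

Lemma conjcE (x : C) : x^*%R = complex.Re x -i* complex.Im x.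
Proof. by case: x. Qed.

Lemma cmeasurable_cst (c : C) : cmeasurable (fun=> c).
Proof. by split; exact: measurable_cst. Qed.

Lemma cmeasurableM (X Y : T -> C) :
  cmeasurable X -> cmeasurable Y -> cmeasurable (fun t => X t * Y t).
Proof.
move=> [mX nX] [mY nY]; split.
  under eq_fun do rewrite ReM.
  by apply: measurable_funB; exact: measurable_funM.
under eq_fun do rewrite ImM.
by apply: measurable_funD; exact: measurable_funM.
Qed.

Lemma cmeasurableX (X : T -> C) n :
  cmeasurable X -> cmeasurable (fun t => X t ^+ n).
Proof.
move=> mX; elim: n => [|n IH].
  by under eq_fun do rewrite expr0; exact: cmeasurable_cst.
by under eq_fun do rewrite exprS; exact: cmeasurableM.
Qed.

Lemma cmeasurable_prod (I : Type) (r : seq I) (X : I -> T -> C) :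
  (forall i, cmeasurable (X i)) -> cmeasurable (fun t => \prod_(i <- r) X i t).
Proof.
move=> mX; elim: r => [|i r IH].
  by under eq_fun do rewrite big_nil; exact: cmeasurable_cst.
by under eq_fun do rewrite big_cons; exact: cmeasurableM.
Qed.

Lemma cmeasurable_conj (X : T -> C) :
  cmeasurable X -> cmeasurable (fun t => (X t)^*%R).
Proof.
move=> [mX nX]; split; under eq_fun do rewrite conjcE /=; first exact: mX.
exact: measurable_funN nX.
Qed.

Variable P : probability T R.
Local Notation E := (cexpectation P).

Definition cintegrable (X : T -> C) : Prop :=
  P.-integrable setT (EFin \o (fun t => complex.Re (X t))) /\
  P.-integrable setT (EFin \o (fun t => complex.Im (X t))).

Lemma cexpectationE (X : T -> C) : E X =
  (\int[P]_t complex.Re (X t))%R +i* (\int[P]_t complex.Im (X t))%R.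
Proof. by rewrite /cexpectation unlock. Qed.

Lemma cintegrable_real (f : T -> R) :
  P.-integrable setT (EFin \o f) -> cintegrable (fun t => (f t)%:C).
Proof. by move=> h; split => //; exact: integrable0. Qed.

Lemma cexpectation_real (f : T -> R) :
  E (fun t => (f t)%:C) = (\int[P]_t f t)%R%:C.
Proof.
rewrite cexpectationE /=; congr (_ +i* _).
by rewrite /Rintegral integral0.
Qed.

Lemma cintegrable_cst (c : C) : cintegrable (fun=> c).
Proof. by split; exact: finite_measure_integrable_cst. Qed.

Lemma cexpectation_cst (c : C) : E (fun=> c) = c.
Proof.
rewrite cexpectationE !Rintegral_cst //.
have -> : fine (P setT) = 1 by rewrite probability_setT.
rewrite !mulr1.
by case: c.
Qed.

Lemma cintegrableD (X Y : T -> C) :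
  cintegrable X -> cintegrable Y -> cintegrable (fun t => X t + Y t).
Proof.
move=> [iX jX] [iY jY]; split.
  have -> : EFin \o (fun t => complex.Re (X t + Y t)) =
    ((EFin \o (fun t => complex.Re (X t))) \+ (EFin \o (fun t => complex.Re (Y t))))%E.
    by apply/funext => t /=; rewrite ReD.
  exact: integrableD.
have -> : EFin \o (fun t => complex.Im (X t + Y t)) =
  ((EFin \o (fun t => complex.Im (X t))) \+ (EFin \o (fun t => complex.Im (Y t))))%E.
  by apply/funext => t /=; rewrite ImD.
exact: integrableD.
Qed.

Lemma cexpectationD (X Y : T -> C) : cintegrable X -> cintegrable Y ->
  E (fun t => X t + Y t) = E X + E Y.
Proof.
move=> [iX jX] [iY jY]; rewrite !cexpectationE.
under [X in X +i* _]eq_Rintegral do rewrite ReD.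
under [X in _ +i* X]eq_Rintegral do rewrite ImD.
by rewrite !RintegralD.
Qed.

Lemma cintegrableZ (c : C) (X : T -> C) :
  cintegrable X -> cintegrable (fun t => c * X t).
Proof.
case: c => a b [iX jX]; split.
  have -> : EFin \o (fun t => complex.Re ((a +i* b) * X t)) =
    ((fun t => a%:E * (complex.Re (X t))%:E) \-
     (fun t => b%:E * (complex.Im (X t))%:E))%E.
    by apply/funext => t /=; rewrite ReM.
  by apply: integrableB => //; exact: integrableZl.
have -> : EFin \o (fun t => complex.Im ((a +i* b) * X t)) =
  ((fun t => a%:E * (complex.Im (X t))%:E) \+
   (fun t => b%:E * (complex.Re (X t))%:E))%E.
  by apply/funext => t /=; rewrite ImM.
by apply: integrableD => //; exact: integrableZl.
Qed.

Lemma cexpectationZ (c : C) (X : T -> C) : cintegrable X ->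
  E (fun t => c * X t) = c * E X.
Proof.
case: c => a b [iX jX]; rewrite !cexpectationE.
under [X in X +i* _]eq_Rintegral do rewrite ReM.
under [X in _ +i* X]eq_Rintegral do rewrite ImM.
have iZ k (f : T -> R) : P.-integrable setT (EFin \o f) ->
  P.-integrable setT (EFin \o (fun t => k * f t)) by exact: integrableZl.
rewrite RintegralB ?RintegralD //; try exact: iZ.
by rewrite !RintegralZl.
Qed.

Lemma cintegrable_sum (I : Type) (r : seq I) (Q : pred I) (X : I -> T -> C) :
  (forall i, Q i -> cintegrable (X i)) ->
  cintegrable (fun t => \sum_(i <- r | Q i) X i t).
Proof.
move=> iX; elim: r => [|i r IH].
  have -> : (fun t => \sum_(i <- [::] | Q i) X i t) = (fun=> 0).
    by apply/funext => t; rewrite big_nil.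
  exact: cintegrable_cst.
have -> : (fun t => \sum_(i <- i :: r | Q i) X i t) =
    if Q i then (fun t => X i t + \sum_(i <- r | Q i) X i t)
    else (fun t => \sum_(i <- r | Q i) X i t).
  by case: ifP => Qi; apply/funext => t; rewrite big_cons Qi.
by case: ifP => // Qi; apply: cintegrableD => //; exact: iX.
Qed.

Lemma cexpectation_sum (I : Type) (r : seq I) (Q : pred I) (X : I -> T -> C) :
  (forall i, Q i -> cintegrable (X i)) ->
  E (fun t => \sum_(i <- r | Q i) X i t) = \sum_(i <- r | Q i) E (X i).
Proof.
move=> iX; elim: r => [|i r IH].
  have -> : (fun t => \sum_(i <- [::] | Q i) X i t) = (fun=> 0).
    by apply/funext => t; rewrite big_nil.
  by rewrite big_nil cexpectation_cst.
have -> : (fun t => \sum_(i <- i :: r | Q i) X i t) =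
    if Q i then (fun t => X i t + \sum_(i <- r | Q i) X i t)
    else (fun t => \sum_(i <- r | Q i) X i t).
  by case: ifP => Qi; apply/funext => t; rewrite big_cons Qi.
rewrite big_cons; case: ifP => // Qi; rewrite -IH; apply: cexpectationD; first exact: iX.
exact: cintegrable_sum.
Qed.

Lemma cexpectation_conj (X : T -> C) : cintegrable X ->
  E (fun t => (X t)^*%R) = (E X)^*%R.
Proof.
move=> [iX jX]; rewrite !cexpectationE.
under [X in X +i* _]eq_Rintegral do rewrite conjcE /=.
under [X in _ +i* X]eq_Rintegral do rewrite conjcE /= -mulN1r.
by rewrite conjcE RintegralZl //= mulN1r.
Qed.

(** Linear span of [B]. The constructor [cspan_comb] covers both sums (a = 1) and multiples (g = 0),
    so that inductions have three cases. *)
Inductive cspan (B : (T -> C) -> Prop) : (T -> C) -> Prop :=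
| cspan0 : cspan B (fun=> 0)
| cspan_base f : B f -> cspan B f
| cspan_comb a f g :
    cspan B f -> cspan B g -> cspan B (fun t => a * f t + g t).

(** Multiplication by [u] is linear, so only the generators need checking. This lets a power be
    built one factor at a time. *)
Lemma cspanM (B : (T -> C) -> Prop) (u : T -> C) :
  (forall f, B f -> cspan B (fun t => u t * f t)) ->
  forall f, cspan B f -> cspan B (fun t => u t * f t).
Proof.
move=> uB f; elim=> {f} [|f Bf|a f g _ IHf _ IHg].
- by under eq_fun do rewrite mulr0; exact: cspan0.
- exact: uB.
- under eq_fun do rewrite mulrDr mulrCA.
  exact: cspan_comb.
Qed.

(** Integrability of the product is part of the notion because additivity of the expectation
    requires it when factors are expanded. *)
Definition indep_class (I : finType) (B : I -> (T -> C) -> Prop) : Prop :=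
  forall f : I -> T -> C, (forall i, B i (f i)) ->
    cintegrable (fun t => \prod_i f i t) /\
    E (fun t => \prod_i f i t) = \prod_i E (f i).

(* Both sides of the product formula are linear in each factor separately, so
   the factors can be replaced by linear combinations one at a time. *)
Lemma indep_class_span (I : finType) (B : I -> (T -> C) -> Prop) :
  (forall i f, B i f -> cintegrable f) ->
  indep_class B -> indep_class (fun i => cspan (B i)).
Proof.
move=> iB hB.
have iS i f : cspan (B i) f -> cintegrable f.
  elim=> {f} [|f Bf|a f g _ IHf _ IHg]; first exact: cintegrable_cst.
    exact: iB Bf.
  by apply: cintegrableD => //; exact: cintegrableZ.
(* [r] collects the indices whose factor is only known to lie in the span; all other factors are
   generators. Each round removes one index. *)
suff main (r : seq I) f : (forall i, i \notin r -> B i (f i)) ->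
    (forall i, i \in r -> cspan (B i) (f i)) ->
    cintegrable (fun t => \prod_i f i t) /\
    E (fun t => \prod_i f i t) = \prod_i E (f i).
  by move=> f hf; apply: (main (enum I)) => i; rewrite mem_enum.
elim: r f => [|i r IH] f hN hI; first by apply: hB => i; exact: hN.
have [ir|ir] := boolP (i \in r).
  apply: IH => j hj; last by apply: hI; rewrite inE hj orbT.
  by apply: hN; rewrite inE negb_or hj andbT; apply: contraNneq hj => ->.
pose upd g j := if j == i then g else f j.
suff [] : cintegrable (fun t => \prod_j upd (f i) j t) /\
    E (fun t => \prod_j upd (f i) j t) = \prod_j E (upd (f i) j).
  have -> : upd (f i) = f by apply/funext => j; rewrite /upd; case: eqP => [->|].
  by [].
have updP g t : \prod_j upd g j t = g t * \prod_(j | j != i) f j t.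
  rewrite (bigD1 i) //= /upd eqxx; congr (_ * _).
  by apply: eq_bigr => j /negbTE ->.
have updE g : \prod_j E (upd g j) = E g * \prod_(j | j != i) E (f j).
  rewrite (bigD1 i) //= /upd eqxx; congr (_ * _).
  by apply: eq_bigr => j /negbTE ->.
(* Induction on how [f i] is spanned, the other factors being frozen in [upd]. *)
have : cspan (B i) (f i) by apply: hI; rewrite mem_head.
elim=> [|g Bg|a g1 g2 s1 [i1 e1] s2 [i2 e2]].
- split; first by under eq_fun do rewrite updP mul0r; exact: cintegrable_cst.
  under eq_fun do rewrite updP mul0r.
  by rewrite updE !cexpectation_cst mul0r.
- apply: IH => j hj; rewrite /upd; case: eqP => [->//|/eqP ji].
    by apply: hN; rewrite inE negb_or ji.
    exact: cspan_base.
  by apply: hI; rewrite inE hj orbT.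
- have eqP : (fun t => \prod_j upd (fun t => a * g1 t + g2 t) j t) =
      (fun t => a * \prod_j upd g1 j t + \prod_j upd g2 j t).
    by apply/funext => t; rewrite !updP mulrDl mulrA.
  rewrite eqP; split; first by apply: cintegrableD => //; exact: cintegrableZ.
  rewrite cexpectationD //; last exact: cintegrableZ.
  rewrite cexpectationZ // e1 e2 !updE mulrA -mulrDl; congr (_ * _).
  rewrite cexpectationD ?cexpectationZ //; try exact: iS s1; try exact: iS s2.
  by apply: cintegrableZ; exact: iS s1.
Qed.

End ComplexExpectation.

(** * From independent events to expectations of products *)

Section IndependentExpectation.
Context d (T : measurableType d) (R : realType) (P : probability T R).
Local Notation C := R[i].
Local Notation E := (cexpectation P).
Local Open Scope classical_set_scope.

(** [G] is any family of events, so that one notion covers the preimages under a single real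
    coordinate and the sigma-algebra of a whole vector. *)
Definition gmeasurable (G : set (set T)) (f : T -> R) : Prop :=
  forall B, measurable B -> G (f @^-1` B).

Lemma gmeasurable_comp (G : set (set T)) (f : T -> R) (g : R -> R) :
  measurable_fun setT g -> gmeasurable G f -> gmeasurable G (g \o f).
Proof.
move=> mg mf B mB; rewrite comp_preimage; apply: mf.
by rewrite -[X in measurable X]setTI; exact: mg.
Qed.

Section Product.
Variables (I : finType) (G : I -> set (set T)).
Hypotheses (mG : forall i, G i `<=` measurable)
  (indepG : mutually_independent P G).

Lemma gmeasurable_measurable i f : gmeasurable (G i) f -> measurable_fun setT f.
Proof. by move=> mf _ B mB; rewrite setTI; apply: mG; exact: mf. Qed.

(* The indicators of a product over independent events are replaced by
   functions one index at a time. *)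
Lemma Rintegral_prod_indep (f : I -> T -> R) :
  (forall i, gmeasurable (G i) (f i)) -> (forall i t, 0 <= f i t) ->
  (forall i, P.-integrable setT (EFin \o f i)) ->
  (\int[P]_t (\prod_i f i t)%:E = (\prod_i \int[P]_t f i t)%R%:E)%E.
Proof.
move=> gf f0 fi.
have mf i : measurable_fun setT (f i) by exact: gmeasurable_measurable (gf i).
(* [r] lists the factors already turned into functions, [J] those that are still indicators. *)
suff main (r : seq I) (J : {set I}) (A : I -> set T) : uniq r ->
    (forall i, i \in J -> i \notin r) -> (forall i, G i (A i)) ->
    (\int[P]_t (\prod_(i <- r) f i t * \prod_(i in J) \1_(A i) t)%:E =
     ((\prod_(i <- r) \int[P]_t f i t) * \prod_(i in J) fine (P (A i)))%R%:E)%E.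
  have := main (index_enum I) finset.set0 (fun i => f i @^-1` setT).
  rewrite !big_set0 mulr1 => <-; first last.
  - by move=> i; exact: gf.
  - by move=> i; rewrite inE.
  - exact: index_enum_uniq.
  by apply: eq_integral => t _; rewrite big_set0 mulr1.
elim: r J A => [|i r IH] J A /=.
  move=> _ _ GA; rewrite big_nil mul1r.
  have mA : measurable (\bigcap_(i in [set` J]) A i).
    by apply: fin_bigcap_measurable => // j _; exact: mG.
  transitivity (P (\bigcap_(i in [set` J]) A i)).
    rewrite -[X in P X]setIT -integral_indic //; apply: eq_integral => t _.
    rewrite big_nil mul1r; congr EFin; rewrite indicE.
    case: (asboolP ((\bigcap_(i in [set` J]) A i) t)) => h.
      rewrite mem_set // big1 // => j jJ; rewrite indicE mem_set //.
      exact: h.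
    rewrite memNset //=.
    have [j jJ nA] : exists2 j, j \in J & ~ A j t.
      apply: contrapT => hn; apply: h => j jJ; apply: contrapT => nA.
      by apply: hn; exists j.
    by rewrite (bigD1 j) //= indicE memNset // mul0r.
  rewrite indepG // -prodEFin; apply: eq_bigr => j _.
  by rewrite fineK // fin_num_measure //; exact: mG.
move=> /andP[ir ur] hJ GA.
(* [g] gathers the remaining factors and [k] is its mean. The image under [f i] of the measure of
   density [g] is [k] times the law of [f i]: this is the induction hypothesis with [i] added to
   [J]. *)
pose g t := \prod_(j <- r) f j t * \prod_(j in J) \1_(A j) t : R.
pose k := (\prod_(j <- r) \int[P]_t f j t) * \prod_(j in J) fine (P (A j)).
have iJ : i \notin J by apply/negP => /hJ; rewrite mem_head.
have g0 t : 0 <= g t.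
  by rewrite mulr_ge0 ?prodr_ge0 // => j _; rewrite indicE.
have k0 : 0 <= k.
  rewrite mulr_ge0 ?prodr_ge0 // => j _; first exact: Rintegral_ge0.
  by rewrite fine_ge0.
have mg : measurable_fun setT g.
  apply: measurable_funM.
    exact: measurable_prod.
  have -> : (fun t => \prod_(j in J) \1_(A j) t) =
      (fun t => \prod_(j <- enum J) \1_(A j) t) :> (T -> R).
    by apply/funext => t; rewrite big_enum.
  apply: measurable_prod => j _.
  by apply: measurable_indic; exact: mG.
(* The comparison of weighted measures asks for a function that is nonnegative on the whole line,
   hence the absolute value in place of the identity. *)
transitivity (\int[P]_t (`|f i t| * g t)%:E)%E.
  by apply: eq_integral => t _; rewrite ger0_norm // big_cons /g mulrA.
rewrite (@eq_ge0_integral_weighted _ _ _ _ _ _ _ P P (f i) (f i) g (cst k)) //=.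
- rewrite big_cons -mulrA -/k [in RHS]mulrC.
  transitivity (\int[P]_t (k%:E * (f i t)%:E))%E.
    by apply: eq_integral => t _; rewrite ger0_norm // mulrC EFinM.
  have fiE : (\int[P]_t (f i t)%:E = (\int[P]_t f i t)%R%:E)%E.
    by rewrite /Rintegral fineK //; exact: integrable_fin_num (fi i).
  by rewrite (integralZl measurableT (fi i)) [X in (_ * X)%E]fiE -EFinM.
- move=> B mB.
  (* As [i] lies outside [J], its event can be overwritten by the one under test. *)
  pose A' j := if j == i then f i @^-1` B else A j.
  have GA' j : G j (A' j).
    by rewrite /A'; case: eqP => [->|_]; [exact: gf|exact: GA].
  have A'i : A' i = f i @^-1` B by rewrite /A' eqxx.
  have A'j j : j \in J -> A' j = A j.
    by rewrite /A'; case: eqP => [-> /(negP iJ)|].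
  transitivity (fine (P (f i @^-1` B)) * k)%:E.
    have /IH := ur => /(_ (i |: J)%SET A').
    have -> : \prod_(j in (i |: J)%SET) fine (P (A' j)) =
        fine (P (f i @^-1` B)) * \prod_(j in J) fine (P (A j)).
      rewrite big_setU1 //= A'i; congr (_ * _).
      by apply: eq_bigr => j jJ; rewrite A'j.
    rewrite mulrCA -/k => <- //.
      apply: eq_integral => t _; congr EFin; rewrite big_setU1 //= A'i mulrCA.
      congr (_ * (_ * _)).
      by apply: eq_bigr => j jJ; rewrite A'j.
    move=> j; rewrite !inE => /predU1P[->//|/hJ].
    by rewrite inE negb_or => /andP[].
  have mfB : measurable (f i @^-1` B) by apply: mG; exact: gf.
  transitivity (\int[P]_t (k%:E * (\1_(f i @^-1` B) t)%:E))%E.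
    have iB := integrable_indic P mfB.
    rewrite (integralZl measurableT iB).
    by rewrite integral_indic // setIT EFinM fineK ?fin_num_measure // muleC.
  by apply: eq_integral => t _; rewrite -EFinM mulrC.
Qed.

(** Each factor is a combination, with coefficients 1, -1, i and -i, of the positive and negative
    parts of its real and imaginary parts. These are nonnegative, integrable and still measurable
    for [G i]. *)
Lemma cexpectation_prod_indep (f : I -> T -> C) :
  (forall i, cintegrable P (f i)) ->
  (forall i, gmeasurable (G i) (fun t => complex.Re (f i t))) ->
  (forall i, gmeasurable (G i) (fun t => complex.Im (f i t))) ->
  cintegrable P (fun t => \prod_i f i t) /\
  E (fun t => \prod_i f i t) = \prod_i E (f i).
Proof.
pose B i (h : T -> C) := exists g : T -> R, [/\ h = (fun t => (g t)%:C),
  gmeasurable (G i) g, forall t, 0 <= g t & P.-integrable setT (EFin \o g)].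
move=> fi fRe fIm; apply: (@indep_class_span _ _ _ _ _ B).
- by move=> i h [g [-> _ _ gi]]; exact: cintegrable_real.
- move=> h /choice[g hg].
  have gi i : P.-integrable setT (EFin \o g i) by case: (hg i).
  have prodE : (fun t => \prod_i h i t) = (fun t => (\prod_i g i t)%:C).
    apply/funext => t; rewrite rmorph_prod; apply: eq_bigr => i _.
    by case: (hg i) => ->.
  have gg i : gmeasurable (G i) (g i) by case: (hg i).
  have g0 i t : 0 <= g i t by case: (hg i).
  have intE := Rintegral_prod_indep gg g0 gi.
  rewrite prodE; split.
    apply: cintegrable_real; apply/integrableP; split.
      apply/measurable_EFinP; apply: measurable_prod => i _.
      exact: gmeasurable_measurable (gg i).
    under eq_integral => t _.
      rewrite /= ger0_norm; last exact: prodr_ge0.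
      over.
    by rewrite intE ltry.
  rewrite cexpectation_real {1}/Rintegral intE /= rmorph_prod.
  apply: eq_bigr => i _.
  by case: (hg i) => -> _ _ _; rewrite cexpectation_real.
move=> i.
pose pos (x : R) := Num.max x 0.
have mpos : measurable_fun setT pos by exact: measurable_maxr.
have mneg : measurable_fun setT (fun x : R => pos (- x)) by exact: measurableT_comp.
have ipos (g : T -> R) : P.-integrable setT (EFin \o g) ->
    P.-integrable setT (EFin \o (fun t => pos (g t))).
  by move=> gi; have := integrable_funrpos measurableT gi.
have ineg (g : T -> R) : P.-integrable setT (EFin \o g) ->
    P.-integrable setT (EFin \o (fun t => pos (- g t))).
  by move=> gi; have := integrable_funrneg measurableT gi.
have spos (g : T -> R) : gmeasurable (G i) g -> P.-integrable setT (EFin \o g) ->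
    cspan (B i) (fun t => (pos (g t))%:C).
  move=> gg gi; apply: cspan_base; exists (fun t => pos (g t)); split => //.
  - exact: gmeasurable_comp mpos gg.
  - by move=> t; rewrite le_max lexx orbT.
  - exact: ipos.
have sneg (g : T -> R) : gmeasurable (G i) g -> P.-integrable setT (EFin \o g) ->
    cspan (B i) (fun t => (pos (- g t))%:C).
  move=> gg gi; apply: cspan_base; exists (fun t => pos (- g t)); split => //.
  - exact: gmeasurable_comp mneg gg.
  - by move=> t; rewrite le_max lexx orbT.
  - exact: ineg.
have posB (x : R) : x = pos x - pos (- x) by rewrite subr_max0.
have [iRe iIm] := fi i.
have -> : f i = (fun t => 1 * (pos (complex.Re (f i t)))%:C +
    ((- 1) * (pos (- complex.Re (f i t)))%:C +
    ('i * (pos (complex.Im (f i t)))%:C +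
    ((- 'i) * (pos (- complex.Im (f i t)))%:C + 0)))).
  apply/funext => t; rewrite [LHS]complexE {1}(posB (complex.Re (f i t))).
  rewrite {1}(posB (complex.Im (f i t))) !rmorphB.
  have comb (a b c e w : C) : a - b + w * (c - e) =
    1 * a + (- 1 * b + (w * c + (- w * e + 0))) by ring.
  exact: comb.
apply: cspan_comb; first exact: spos.
apply: cspan_comb; first exact: sneg.
apply: cspan_comb; first exact: spos.
by apply: cspan_comb; [exact: sneg|exact: cspan0].
Qed.

End Product.
End IndependentExpectation.

(** * Moments of complex normal vectors and of the sources *)

Section ComplexNormal.
Context d (T : measurableType d) (R : realType) (P : probability T R).
Local Notation C := R[i].
Local Notation E := (cexpectation P).
Variables (n : nat) (X : T -> 'cV[C]_n).
Hypothesis X_normal : standard_complex_normal P X.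

Let mX ib : measurable_fun setT (coordinate X ib).
Proof. by case: X_normal. Qed.

Let entryE i t : X t i 0 =
  (coordinate X (i, false) t)%:C + 'i * (coordinate X (i, true) t)%:C.
Proof. by rewrite [LHS]complexE. Qed.

Lemma coordinate_moments (e : 'I_n * bool -> nat) :
  cintegrable P (fun t => \prod_ib (coordinate X ib t ^+ e ib)%:C) /\
  E (fun t => \prod_ib (coordinate X ib t ^+ e ib)%:C) =
    \prod_ib (normal_moment R (e ib))%:C.
Proof.
case: X_normal => _ law indep.
have mom ib := normal_moment_integral (mX ib) (law ib) (e ib).
have [] := cexpectation_prod_indep _ indep
    (f := fun ib t => (coordinate X ib t ^+ e ib)%:C).
- by move=> ib A [B mB <-]; exact: mX.
- by move=> ib; apply: cintegrable_real; case: (mom ib).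
- move=> ib B mB; exists ((fun x => x ^+ e ib) @^-1` B)%classic => //.
    by rewrite -[X in measurable X]setTI; exact: measurable_funX.
  by rewrite setTI.
- move=> ib B mB; exists ((cst 0 : R -> R) @^-1` B)%classic => //.
    by rewrite -[X in measurable X]setTI; exact: measurable_cst.
  by rewrite setTI.
move=> h1 h2; split => //; rewrite h2; apply: eq_bigr => ib _.
by rewrite cexpectation_real; case: (mom ib) => _ ->.
Qed.

Definition entry_monomial i (e g : nat) (t : T) : C :=
  (coordinate X (i, false) t ^+ e * coordinate X (i, true) t ^+ g)%:C.

Lemma prod_entry_monomials (e g : 'I_n -> nat) :
  cintegrable P (fun t => \prod_i entry_monomial i (e i) (g i) t) /\
  E (fun t => \prod_i entry_monomial i (e i) (g i) t) =
    \prod_i (normal_moment R (e i) * normal_moment R (g i))%:C.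
Proof.
pose h (ib : 'I_n * bool) := if ib.2 then g ib.1 else e ib.1.
have prodE (F : 'I_n * bool -> C) :
    \prod_ib F ib = \prod_i (F (i, false) * F (i, true)).
  rewrite (eq_bigr (fun ib => F (ib.1, ib.2))); last by case.
  rewrite -(pair_bigA _ (fun i b => F (i, b))) /=.
  by apply: eq_bigr => i _; rewrite big_bool mulrC.
have [h1 h2] := coordinate_moments h.
have fE : (fun t => \prod_i entry_monomial i (e i) (g i) t) =
    (fun t => \prod_ib (coordinate X ib t ^+ h ib)%:C).
  apply/funext => t; rewrite prodE; apply: eq_bigr => i _.
  by rewrite /entry_monomial rmorphM.
rewrite fE; split => //; rewrite h2 prodE; apply: eq_bigr => i _.
by rewrite [RHS]rmorphM.
Qed.

Lemma entry_monomial_moment i e g :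
  cintegrable P (entry_monomial i e g) /\
  E (entry_monomial i e g) = (normal_moment R e * normal_moment R g)%:C.
Proof.
(* Exponents 0 away from [i] contribute moments of order 0, which equal 1. *)
pose e' j := if j == i then e else 0%N; pose g' j := if j == i then g else 0%N.
have [m0 _ _ _ _] := normal_momentE R.
have [h1 h2] := prod_entry_monomials e' g'.
have fE : (fun t => \prod_j entry_monomial j (e' j) (g' j) t) =
    entry_monomial i e g.
  apply/funext => t; rewrite (bigD1 i) //= /e' /g' eqxx big1 ?mulr1 // => j ji.
  by rewrite (negbTE ji) /entry_monomial !expr0 mulr1.
rewrite fE in h1 h2; split => //; rewrite h2 (bigD1 i) //= /e' /g' eqxx.
by rewrite big1 ?mulr1 // => j ji; rewrite (negbTE ji) m0 mulr1.
Qed.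

(** Counting an entry and its conjugate separately makes circular symmetry visible: the mean
    vanishes unless the two exponents agree. *)
Definition entry_power i (a b : nat) (t : T) : C :=
  X t i 0 ^+ a * (X t i 0)^*%R ^+ b.

Let B i (f : T -> C) := exists e g, f = entry_monomial i e g.

(** With U and V the real and imaginary parts, multiplication by U + c V maps the span of the real
    monomials into itself. Powers grow one factor at a time, with c = i for the entry and c = -i for
    its conjugate. *)
Let entry_power_span i a b : cspan (B i) (entry_power i a b).
Proof.
have stepU f : B i f ->
    cspan (B i) (fun t => (coordinate X (i, false) t)%:C * f t).
  move=> [e [g ->]]; apply: cspan_base; exists e.+1, g; apply/funext => t.
  by rewrite /entry_monomial exprS -!rmorphM /= mulrA.
have stepV f : B i f ->
    cspan (B i) (fun t => (coordinate X (i, true) t)%:C * f t).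
  move=> [e [g ->]]; apply: cspan_base; exists e, g.+1; apply/funext => t.
  by rewrite /entry_monomial exprS -!rmorphM /= mulrCA.
have step (c : C) f : cspan (B i) f -> cspan (B i) (fun t =>
    ((coordinate X (i, false) t)%:C + c * (coordinate X (i, true) t)%:C) * f t).
  move=> sf.
  have -> : (fun t => ((coordinate X (i, false) t)%:C +
      c * (coordinate X (i, true) t)%:C) * f t) =
      (fun t => c * ((coordinate X (i, true) t)%:C * f t) +
        (coordinate X (i, false) t)%:C * f t).
    by apply/funext => t; rewrite mulrDl addrC mulrA.
  by apply: cspan_comb; exact: cspanM sf.
have sp b' : cspan (B i) (entry_power i 0 b').
  elim: b' => [|b' IH].
    apply: cspan_base; exists 0%N, 0%N; apply/funext => t.
    by rewrite /entry_power /entry_monomial !expr0 !mulr1.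
  have -> : entry_power i 0 b'.+1 = (fun t => ((coordinate X (i, false) t)%:C +
      (- 'i) * (coordinate X (i, true) t)%:C) * entry_power i 0 b' t).
    apply/funext => t; rewrite /entry_power !expr0 !mul1r exprS; congr (_ * _).
    by rewrite conjcE mulNr; apply/eqP; rewrite eq_complex /=; apply/andP;
      split; apply/eqP; rewrite /coordinate /=; ring.
  exact: step.
elim: a => [|a IH]; first exact: sp.
have -> : entry_power i a.+1 b = (fun t => ((coordinate X (i, false) t)%:C +
    'i * (coordinate X (i, true) t)%:C) * entry_power i a b t).
  by apply/funext => t; rewrite /entry_power exprS -mulrA -entryE.
exact: step.
Qed.

Lemma prod_entry_powers (a b : 'I_n -> nat) :
  cintegrable P (fun t => \prod_i entry_power i (a i) (b i) t) /\
  E (fun t => \prod_i entry_power i (a i) (b i) t) =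
    \prod_i E (entry_power i (a i) (b i)).
Proof.
apply: (@indep_class_span _ _ _ _ _ B) => [i f [e [g ->]]||i].
- by case: (entry_monomial_moment i e g).
- move=> f hf.
  have /choice[e he] : forall i, exists eg, f i = entry_monomial i eg.1 eg.2.
    by move=> i; have [e [g ->]] := hf i; exists (e, g).
  have fE : f = fun i => entry_monomial i (e i).1 (e i).2 by apply/funext.
  have [h1 h2] := prod_entry_monomials (fun i => (e i).1) (fun i => (e i).2).
  rewrite fE; split => //; rewrite h2; apply: eq_bigr => i _.
  by case: (entry_monomial_moment i (e i).1 (e i).2) => _ ->.
- exact: entry_power_span.
Qed.

(** Two plain and two conjugated entries never produce an exponent above 2. Means are read off an
    expansion into real monomials; for instance E|X|^4 = 3/4 + 2 * 1/4 + 3/4 = 2. *)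
Lemma entry_power_moment i (a b : nat) : (a <= 2)%N -> (b <= 2)%N ->
  E (entry_power i a b) = if a == b then (a`!)%:R else 0.
Proof.
have iP a' b' : cintegrable P (entry_power i a' b').
  have := entry_power_span i a' b'.
  elim=> [|f [e [g ->]]|c f g _ IHf _ IHg]; first exact: cintegrable_cst.
    by case: (entry_monomial_moment i e g).
  by apply: cintegrableD => //; exact: cintegrableZ.
have conjE a' b' : E (entry_power i b' a') = (E (entry_power i a' b'))^*%R.
  rewrite -cexpectation_conj //; congr (cexpectation P _); apply/funext => t.
  by rewrite /entry_power rmorphM !rmorphXn /= conjCK mulrC.
(* A triple holds a coefficient and the exponents of the real and imaginary parts. In the lists
   below a repeated triple stands for a doubled coefficient. *)
have expand (s : seq (C * nat * nat)) f :
    (forall t, f t = \sum_(x <- s) x.1.1 * entry_monomial i x.1.2 x.2 t) ->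
    E f = \sum_(x <- s) x.1.1 * (normal_moment R x.1.2 * normal_moment R x.2)%:C.
  move=> /funext ->; rewrite cexpectation_sum => [|x _].
    apply: eq_bigr => x _; rewrite cexpectationZ.
      by case: (entry_monomial_moment i x.1.2 x.2) => _ ->.
    by case: (entry_monomial_moment i x.1.2 x.2).
  by apply: cintegrableZ; case: (entry_monomial_moment i x.1.2 x.2).
have [m0 m1 m2 m3 m4] := normal_momentE R.
have expandE a' b' (s : seq (C * nat * nat)) :
    (forall t (x y : R), X t i 0 = x +i* y ->
      (x +i* y) ^+ a' * (x -i* y) ^+ b' =
      \sum_(w <- s) w.1.1 * (x ^+ w.1.2 * y ^+ w.2)%:C) ->
    E (entry_power i a' b') =
      \sum_(w <- s) w.1.1 * (normal_moment R w.1.2 * normal_moment R w.2)%:C.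
  move=> h; apply: expand => t; rewrite /entry_power /entry_monomial /coordinate /=.
  by case: (X t i 0) (h t) => x y /(_ x y erefl).
have ReR (x : R) : complex.Re x%:C = x by [].
have ImR (x : R) : complex.Im x%:C = 0 by [].
have Rexy (x y : R) : complex.Re (x +i* y) = x by [].
have Imxy (x y : R) : complex.Im (x +i* y) = y by [].
have Re1 : complex.Re (1 : C) = 1 by [].
have Im1 : complex.Im (1 : C) = 0 by [].
have Re0 : complex.Re (0 : C) = 0 by [].
have Im0 : complex.Im (0 : C) = 0 by [].
have ReN1 : complex.Re (- 1 : C) = - 1 by [].
have ImN1 : complex.Im (- 1 : C) = 0 by rewrite /= oppr0.
pose cE := (ReN1, ImN1, ReD, ImD, ReM, ImM, ReR, ImR, Rexy, Imxy, Re1, Im1, Re0, Im0).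
have E00 : E (entry_power i 0 0) = 1.
  rewrite (expandE _ _ [:: (1, 0%N, 0%N)]).
    by rewrite big_seq1 /= m0 !mul1r.
  by move=> t x y _; rewrite big_seq1 /= !expr0 !mul1r.
have E10 : E (entry_power i 1 0) = 0.
  rewrite (expandE _ _ [:: (1, 1%N, 0%N); ('i, 0%N, 1%N)]).
    by rewrite !big_cons big_nil /= m0 m1 !(mul0r, mulr0, addr0).
  move=> t x y _; rewrite !big_cons big_nil /=.
  apply/eqP; rewrite eq_complex; apply/andP; split; apply/eqP;
    rewrite ?exprS ?expr0 ?cE; ring.
have E11 : E (entry_power i 1 1) = 1.
  rewrite (expandE _ _ [:: (1, 2%N, 0%N); (1, 0%N, 2%N)]).
    rewrite !big_cons big_nil /= m0 m2 !mul1r !mulr1 addr0 -rmorphD /=.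
    by congr (_%:C); field.
  move=> t x y _; rewrite !big_cons big_nil /=.
  apply/eqP; rewrite eq_complex; apply/andP; split; apply/eqP;
    rewrite ?exprS ?expr0 ?cE; ring.
have E20 : E (entry_power i 2 0) = 0.
  rewrite (expandE _ _ [:: (1, 2%N, 0%N); (- 1, 0%N, 2%N); ('i, 1%N, 1%N); ('i, 1%N, 1%N)]).
    by rewrite !big_cons big_nil /= m0 m1 m2 !(mul0r, mulr0, addr0, mul1r, mulr1) mulN1r subrr.
  move=> t x y _; rewrite !big_cons big_nil /=.
  apply/eqP; rewrite eq_complex; apply/andP; split; apply/eqP;
    rewrite ?exprS ?expr0 ?mulr2n ?cE; ring.
have E21 : E (entry_power i 2 1) = 0.
  rewrite (expandE _ _ [:: (1, 3%N, 0%N); (1, 1%N, 2%N); ('i, 2%N, 1%N); ('i, 0%N, 3%N)]).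
    by rewrite !big_cons big_nil /= m0 m1 m2 m3 !(mul0r, mulr0, addr0).
  move=> t x y _; rewrite !big_cons big_nil /=.
  apply/eqP; rewrite eq_complex; apply/andP; split; apply/eqP;
    rewrite ?exprS ?expr0 ?cE; ring.
have E22 : E (entry_power i 2 2) = 2.
  rewrite (expandE _ _ [:: (1, 4%N, 0%N); (1, 2%N, 2%N); (1, 2%N, 2%N); (1, 0%N, 4%N)]).
    rewrite !big_cons big_nil /= m0 m2 m4 !mul1r !mulr1 addr0 -!rmorphD /=.
    by rewrite -[RHS](rmorph_nat (real_complex R)); congr (_%:C); field.
  move=> t x y _; rewrite !big_cons big_nil /=.
  apply/eqP; rewrite eq_complex; apply/andP; split; apply/eqP;
    rewrite ?exprS ?expr0 ?cE; ring.
(* An excess of conjugates reduces to the previous cases by conjugation. *)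
have E01 : E (entry_power i 0 1) = 0 by rewrite conjE E10 rmorph0.
have E02 : E (entry_power i 0 2) = 0 by rewrite conjE E20 rmorph0.
have E12 : E (entry_power i 1 2) = 0 by rewrite conjE E21 rmorph0.
by case: a => [|[|[|a]]] // _; case: b => [|[|[|b]]].
Qed.
End ComplexNormal.

(** * Measurability with respect to the sigma-algebra of a random vector *)

Section SigmaOf.
Context d (T : measurableType d) (R : realType) (n : nat) (X : T -> 'cV[R[i]]_n).
Local Open Scope classical_set_scope.

(** Naming the generators of [sigma_of] allows [T] to be equipped with that sigma-algebra, so that
    the closure properties of [cmeasurable] apply to it. *)
Definition generating_events : set (set T) :=
  \bigcup_ib preimage_set_system setT (coordinate X ib) measurable.

Lemma sigma_of_measurable :
  complex_random_vector X -> sigma_of X `<=` measurable.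
Proof.
move=> mX; apply: smallest_sub; first exact: sigma_algebra_measurable.
by move=> A [ib _ [B mB <-]]; exact: mX.
Qed.

Lemma entry_cmeasurable_sigma i : @cmeasurable _
  (g_sigma_algebraType generating_events) R (fun t => X t i 0).
Proof.
have m ib : measurable_fun (setT : set (g_sigma_algebraType generating_events))
    (coordinate X ib).
  move=> _ B mB; apply: sub_sigma_algebra.
  by exists ib => //; exists B.
by split; [exact: m (i, false)|exact: m (i, true)].
Qed.

Lemma cmeasurable_gmeasurable (f : T -> R[i]) :
  @cmeasurable _ (g_sigma_algebraType generating_events) R f ->
  gmeasurable (sigma_of X) (fun t => complex.Re (f t)) /\
  gmeasurable (sigma_of X) (fun t => complex.Im (f t)).
Proof.
move=> [mf nf]; split=> B mB.
  by have := mf measurableT B mB; rewrite setTI.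
by have := nf measurableT B mB; rewrite setTI.
Qed.

End SigmaOf.

(** * Combinatorics of the Gaussian pairings *)

Section Wick.
Context (F : fieldType) (I : finType).

(** Rewrites one factor as a product over all indices. Several factors then merge into powers whose
    exponents count coincidences, the form in which moments are known. *)
Lemma prod_expr_delta (f : I -> F) (x : I) : \prod_y f y ^+ (x == y) = f x.
Proof.
rewrite (bigD1 x) //= eqxx expr1 big1 ?mulr1 // => y yx.
by rewrite eq_sym (negbTE yx) expr0.
Qed.

Lemma wick2 (a b : I) :
  \prod_x (if (b == x : nat) == (a == x) then ((b == x : nat)`!)%:R else 0) =
  (a == b)%:R :> F.
Proof.
have [->|ab] := eqVneq a b.
  by rewrite big1 // => x _; rewrite eqxx; case: (b == x).
by rewrite (bigD1 a) //= eqxx (eq_sym b) (negbTE ab) mul0r.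
Qed.

(** The product survives only if the plain indices {b, c} and the conjugated ones {a, e} agree as
    multisets; otherwise one index has unequal exponents and kills it. When all four coincide, 2!
    counts both pairings. *)
Lemma wick4 (a b c e : I) :
  \prod_x (if ((b == x) + (c == x) == (a == x) + (e == x))%N
    then (((b == x) + (c == x))`!)%:R else 0) =
  (a == b)%:R * (c == e)%:R + (a == c)%:R * (b == e)%:R :> F.
Proof.
have zero x (G : I -> F) : G x = 0 -> \prod_y G y = 0.
  by move=> Gx; rewrite (bigD1 x) //= Gx mul0r.
have [ab|ab] := eqVneq a b; have [ac|ac] := eqVneq a c.
- rewrite -ab -ac !mul1r; have [ae|ae] := eqVneq a e.
    rewrite -ae (bigD1 a) //= !eqxx big1 ?mulr1 // => x xa.
    by rewrite (eq_sym a) (negbTE xa).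
  by rewrite addr0 (zero a) // !eqxx (eq_sym e) (negbTE ae).
- rewrite -ab mul1r mul0r addr0; have [ce|ce] := eqVneq c e.
    rewrite big1 // => x _; rewrite -ce eqxx.
    have [ax|_] := eqVneq a x; last by case: (c == x).
    by rewrite -ax (eq_sym c) (negbTE ac).
  rewrite (zero e) // eqxx (negbTE ce) addn0.
  by case: (a == e).
- rewrite -ac mul0r mul1r add0r; have [be|be] := eqVneq b e.
    rewrite big1 // => x _; rewrite -be addnC eqxx.
    have [ax|_] := eqVneq a x; last by case: (b == x).
    by rewrite -ax (eq_sym b) (negbTE ab).
  rewrite (zero e) // eqxx (negbTE be) add0n.
  by case: (a == e).
- rewrite !mul0r addr0 (zero a) // eqxx (eq_sym b) (negbTE ab).
  by rewrite (eq_sym c) (negbTE ac).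
Qed.

End Wick.

(** * Joint moments of the symbols and of the normal sources *)

Section Sources.
Context (d : measure_display) (T : measurableType d) (R : realType).
Variables (P : probability T R) (L K M : nat).
Variables (h : 'I_L -> 'I_K -> 'I_L -> T -> 'cV[R[i]]_M)
          (zbar : 'I_K -> 'I_L -> T -> 'cV[R[i]]_M)
          (s : 'I_K -> 'I_L -> T -> R[i])
          (z : 'I_L -> T -> 'cV[R[i]]_M).
Hypothesis model : uplink_model P h zbar s z.
Local Notation C := R[i].
Local Notation E := (cexpectation P).

(* The sources of [source_sigma] other than the symbols. *)
Definition normal_source : Type := 'I_L * 'I_K * 'I_L + 'I_K * 'I_L + 'I_L.
HB.instance Definition _ := Finite.on normal_source.

Definition source_vector (u : normal_source) : T -> 'cV[C]_M :=
  match u with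
  | inl (inl (j, k, n)) => h j k n
  | inl (inr (k, j)) => zbar k j
  | inr j => z j
  end.

Lemma source_vector_normal u : standard_complex_normal P (source_vector u).
Proof.
case: model => hn zn dn _ _ _ _.
by case: u => [[[[j k] n]|[k j]]|j] /=; [exact: hn|exact: zn|exact: dn].
Qed.

(** Integrability of the symbol is deduced from its power: real and imaginary parts are bounded by
    the integrable 1 + |s|^2. *)
Lemma symbol_moment m n (c e : nat) : (c <= 1)%N -> (e <= 1)%N ->
  cintegrable P (fun t => s m n t ^+ c * (s m n t)^*%R ^+ e) /\
  E (fun t => s m n t ^+ c * (s m n t)^*%R ^+ e) = (c == e)%:R.
Proof.
case: model => _ _ _ /(_ m n) ms /(_ m n) s0 /(_ m n) s1 _.
have mRe : measurable_fun setT (fun t => complex.Re (s m n t)).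
  have := ms (0, false); rewrite /coordinate /symbol_vector /=.
  by under eq_fun do rewrite mxE eqxx mulr1n.
have mIm : measurable_fun setT (fun t => complex.Im (s m n t)).
  have := ms (0, true); rewrite /coordinate /symbol_vector /=.
  by under eq_fun do rewrite mxE eqxx mulr1n.
pose w t := complex.Re (s m n t) ^+ 2 + complex.Im (s m n t) ^+ 2.
have wE t : Normc.normc (s m n t) ^+ 2 = w t.
  rewrite /w /Normc.normc; case: (s m n t) => x y /=.
  by rewrite sqr_sqrtr // addr_ge0 ?sqr_ge0.
have w0 t : 0 <= w t by rewrite addr_ge0 ?sqr_ge0.
have mw : measurable_fun setT w.
  by apply: measurable_funD; exact: measurable_funX.
have intw : (\int[P]_t (w t)%:E = 1)%E.
  rewrite -[RHS]s1 unlock; apply: eq_integral => t _.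
  by rewrite wE.
have iw : P.-integrable setT (EFin \o w).
  apply/integrableP; split; first exact/measurable_EFinP.
  under eq_integral do rewrite /= ger0_norm //.
  by rewrite intw ltry.
have i1w : P.-integrable setT (EFin \o (fun t => 1 + w t)).
  have i1 : P.-integrable setT (EFin \o (cst 1 : T -> R)).
    exact: finite_measure_integrable_cst.
  exact: integrableD i1 iw.
have le1 (x y : R) : `|x| <= 1 + (x ^+ 2 + y ^+ 2).
  have h1 := sqr_ge0 (`|x| - 1); have h2 := sqr_ge0 y.
  have h3 := normr_ge0 x; rewrite -[x ^+ 2]real_normK ?num_real //; nra.
have is1 : cintegrable P (s m n).
  split; apply: le_integrable i1w => //.
  - exact/measurable_EFinP.
  - by move=> t _; exact: le_trans (le1 _ _) (ler_norm _).
  - exact/measurable_EFinP.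
  - move=> t _; apply: le_trans (ler_norm _).
    by rewrite /w [X in 1 + X]addrC; exact: le1.
have is1c : cintegrable P (fun t => (s m n t)^*%R).
  case: is1 => i1 i2; split; first by under eq_fun do rewrite conjcE.
  have -> : EFin \o (fun t => complex.Im (s m n t)^*%R) =
      (-%E \o (EFin \o (fun t => complex.Im (s m n t)))).
    by apply/funext => t; rewrite /comp conjcE.
  exact: integrableN.
have sq : (fun t => s m n t * (s m n t)^*%R) = (fun t => (w t)%:C).
  apply/funext => t; rewrite conjcE /w; case: (s m n t) => x y /=.
  apply/eqP; rewrite eq_complex ReM ImM /=; apply/andP; split; apply/eqP; ring.
case: c => [|[|c]] // _; case: e => [|[|e]] // _ /=.
- have -> : (fun t => s m n t ^+ 0 * (s m n t)^*%R ^+ 0) = (fun=> 1).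
    by apply/funext => t; rewrite !expr0 mulr1.
  by split; [exact: cintegrable_cst|exact: cexpectation_cst].
- have -> : (fun t => s m n t ^+ 0 * (s m n t)^*%R ^+ 1) = (fun t => (s m n t)^*%R).
    by apply/funext => t; rewrite expr0 mul1r expr1.
  by split => //; rewrite cexpectation_conj // s0 rmorph0.
- have -> : (fun t => s m n t ^+ 1 * (s m n t)^*%R ^+ 0) = s m n.
    by apply/funext => t; rewrite expr0 mulr1 expr1.
  by split => //; rewrite s0.
- have -> : (fun t => s m n t ^+ 1 * (s m n t)^*%R ^+ 1) = (fun t => (w t)%:C).
    by rewrite -sq; apply/funext => t; rewrite !expr1.
  split; first exact: cintegrable_real.
  by rewrite cexpectation_real /Rintegral intw.
Qed.

End Sources.

Section SourceMoments.
Context (d : measure_display) (T : measurableType d) (R : realType).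
Variables (P : probability T R) (L K M : nat).
Variables (h : 'I_L -> 'I_K -> 'I_L -> T -> 'cV[R[i]]_M)
          (zbar : 'I_K -> 'I_L -> T -> 'cV[R[i]]_M)
          (s : 'I_K -> 'I_L -> T -> R[i])
          (z : 'I_L -> T -> 'cV[R[i]]_M).
Hypothesis model : uplink_model P h zbar s z.
Local Notation C := R[i].
Local Notation E := (cexpectation P).
Local Notation normal_source := (normal_source L K).
Local Notation source_vector := (source_vector h zbar z).

(** The index type of [source_sigma] places the symbols between the training and the data noises;
    this separates them from the normal sources. *)
Lemma prod_source (V : comNzRingType)
    (F : 'I_L * 'I_K * 'I_L + 'I_K * 'I_L + 'I_K * 'I_L + 'I_L -> V)
    (G : normal_source -> V) (S : 'I_K * 'I_L -> V) :
  (forall jkn, F (inl (inl (inl jkn))) = G (inl (inl jkn))) ->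
  (forall kj, F (inl (inl (inr kj))) = G (inl (inr kj))) ->
  (forall mn, F (inl (inr mn)) = S mn) ->
  (forall j, F (inr j) = G (inr j)) ->
  \prod_x F x = \prod_u G u * \prod_mn S mn.
Proof.
move=> h1 h2 h3 h4; rewrite !big_sumType /=.
rewrite (eq_bigr _ (fun i _ => h1 i)) (eq_bigr _ (fun i _ => h2 i)).
rewrite (eq_bigr _ (fun i _ => h3 i)) (eq_bigr _ (fun i _ => h4 i)).
by rewrite -!mulrA; congr (_ * (_ * _)); rewrite mulrC.
Qed.

(** Independence acts at two levels: between the sources by the model, and between the entries of
    one normal source by its law. *)
Lemma source_moments (a b : normal_source -> 'I_M -> nat)
    (c e : 'I_K * 'I_L -> nat) :
  (forall u i, (a u i <= 2)%N) -> (forall u i, (b u i <= 2)%N) ->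
  (forall mn, (c mn <= 1)%N) -> (forall mn, (e mn <= 1)%N) ->
  let F t := (\prod_u \prod_i entry_power (source_vector u) i (a u i) (b u i) t) *
    \prod_mn (s mn.1 mn.2 t ^+ c mn * (s mn.1 mn.2 t)^*%R ^+ e mn) in
  cintegrable P F /\
  E F = (\prod_u \prod_i if a u i == b u i then ((a u i)`!)%:R else 0) *
    \prod_mn (c mn == e mn)%:R.
Proof.
move=> ha hb hc he F.
pose G u t := \prod_i entry_power (source_vector u) i (a u i) (b u i) t.
pose S (mn : 'I_K * 'I_L) t : C :=
  s mn.1 mn.2 t ^+ c mn * (s mn.1 mn.2 t)^*%R ^+ e mn.
pose f (x : 'I_L * 'I_K * 'I_L + 'I_K * 'I_L + 'I_K * 'I_L + 'I_L) : T -> C :=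
  match x with
  | inl (inl (inl jkn)) => G (inl (inl jkn))
  | inl (inl (inr kj)) => G (inl (inr kj))
  | inl (inr mn) => S mn
  | inr j => G (inr j)
  end.
have GI u : cintegrable P (G u) /\ E (G u) =
    \prod_i if a u i == b u i then ((a u i)`!)%:R else 0.
  have [h1 h2] := prod_entry_powers (source_vector_normal model u) (a u) (b u).
  split => //; rewrite h2; apply: eq_bigr => i _.
  by apply: entry_power_moment => //; exact: source_vector_normal model u.
have SI mn : cintegrable P (S mn) /\ E (S mn) = (c mn == e mn)%:R.
  exact: (symbol_moment model _ _ (hc mn) (he mn)).
have GM u : gmeasurable (sigma_of (source_vector u)) (fun t => complex.Re (G u t)) /\
    gmeasurable (sigma_of (source_vector u)) (fun t => complex.Im (G u t)).
  apply: cmeasurable_gmeasurable; apply: cmeasurable_prod => i.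
  by apply: cmeasurableM; apply: cmeasurableX; [|apply: cmeasurable_conj];
    exact: entry_cmeasurable_sigma.
have SM mn :
    gmeasurable (sigma_of (symbol_vector s mn.1 mn.2)) (fun t => complex.Re (S mn t)) /\
    gmeasurable (sigma_of (symbol_vector s mn.1 mn.2)) (fun t => complex.Im (S mn t)).
  apply: cmeasurable_gmeasurable.
  have sE : (fun t => s mn.1 mn.2 t) = (fun t => symbol_vector s mn.1 mn.2 t 0 0).
    by apply/funext => t; rewrite mxE eqxx mulr1n.
  have ms : @cmeasurable _ (g_sigma_algebraType
      (generating_events (symbol_vector s mn.1 mn.2))) R (fun t => s mn.1 mn.2 t).
    by rewrite sE; exact: entry_cmeasurable_sigma.
  by apply: cmeasurableM; apply: cmeasurableX => //; exact: cmeasurable_conj.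
have mG u : (sigma_of (source_vector u) `<=` measurable)%classic.
  by apply: sigma_of_measurable; case: (source_vector_normal model u).
have [] := cexpectation_prod_indep _ (sources_independent model) (f := f).
- case=> [[[[[j k] n]|[k j]]|[m n]]|j]; first exact: (mG (inl (inl (j, k, n)))).
  + exact: (mG (inl (inr (k, j)))).
  + exact: sigma_of_measurable (symbol_measurable model m n).
  + exact: (mG (inr j)).
- by case=> [[[jkn|kj]|mn]|j] /=; [case: (GI (inl (inl jkn)))
    |case: (GI (inl (inr kj)))|case: (SI mn)|case: (GI (inr j))].
- case=> [[[[[j k] n]|[k j]]|[m n]]|j] /=; [case: (GM (inl (inl (j, k, n))))
    |case: (GM (inl (inr (k, j))))|case: (SM (m, n))|case: (GM (inr j))] => //.
- case=> [[[[[j k] n]|[k j]]|[m n]]|j] /=; [case: (GM (inl (inl (j, k, n))))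
    |case: (GM (inl (inr (k, j))))|case: (SM (m, n))|case: (GM (inr j))] => //.
have -> : (fun t => \prod_i f i t) = F.
  by apply/funext => t; apply: (prod_source (G := fun u => G u t) (S := fun mn => S mn t)).
move=> h1 h2; split => //; rewrite h2.
rewrite (prod_source (G := fun u => E (G u)) (S := fun mn => E (S mn))) //.
by congr (_ * _); apply: eq_bigr => u _; [case: (GI u)|case: (SI u)].
Qed.

Definition symbol_or_one (o : option ('I_K * 'I_L)) (t : T) : C :=
  if o is Some mn then s mn.1 mn.2 t else 1.

Definition source_entry (x : normal_source * 'I_M) (t : T) : C :=
  source_vector x.1 t x.2 0.

Let prod_symbol (o : option ('I_K * 'I_L)) (f : 'I_K * 'I_L -> C) :
  \prod_mn f mn ^+ (o == Some mn) = if o is Some mn then f mn else 1.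
Proof.
case: o => [mn|]; first exact: prod_expr_delta.
by rewrite big1.
Qed.

Let symbol_conj o t : (symbol_or_one o t)^*%R =
  if o is Some mn then (s mn.1 mn.2 t)^*%R else 1.
Proof. by case: o => //=; rewrite rmorph1. Qed.

(** If [o] and [o'] differ, some symbol occurs without its conjugate or conversely, and its mean is
    zero. *)
Let prod_symbol_moment (o o' : option ('I_K * 'I_L)) :
  \prod_mn ((o == Some mn : nat) == (o' == Some mn))%:R = (o == o')%:R :> C.
Proof.
have [->|oo'] := eqVneq o o'; first by rewrite big1 // => mn _; rewrite eqxx.
have [mn Hmn] : exists mn, (o == Some mn) != (o' == Some mn).
  case: o oo' => [mn|]; first by exists mn; rewrite eqxx (eq_sym o') (negbTE oo').
  by case: o' => // mn _; exists mn; rewrite eqxx.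
rewrite (bigD1 mn) //=.
by move: Hmn; case: (o == _); case: (o' == _) => // _; rewrite mul0r.
Qed.

Lemma source_wick4 o o' x1 x2 x3 x4 :
  let F t := symbol_or_one o t * (symbol_or_one o' t)^*%R *
    ((source_entry x1 t)^*%R * source_entry x2 t *
     (source_entry x3 t * (source_entry x4 t)^*%R)) in
  cintegrable P F /\
  E F = (o == o')%:R * ((x1 == x2)%:R * (x3 == x4)%:R +
                        (x1 == x3)%:R * (x2 == x4)%:R).
Proof.
(* [a] counts the plain occurrences of an entry, [b] the conjugated ones. *)
pose a u i := ((x2 == (u, i)) + (x3 == (u, i)))%N.
pose b u i := ((x1 == (u, i)) + (x4 == (u, i)))%N.
have le2 (p q : bool) : (p + q <= 2)%N by case: p q => [] [].
have leb1 (p : bool) : (p <= 1)%N by case: p.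
have prodE (f : normal_source * 'I_M -> C) : \prod_u \prod_i f (u, i) = \prod_x f x.
  by rewrite pair_bigA; apply: eq_bigr => -[].
move=> F.
have [h1 h2] := @source_moments a b (fun mn => o == Some mn) (fun mn => o' == Some mn)
  (fun u i => le2 _ _) (fun u i => le2 _ _) (fun mn => leb1 _) (fun mn => leb1 _).
move: h1; set G := (X in cintegrable P X) => h1; have GF : G = F.
  apply/funext => t; rewrite /G /F mulrC; congr (_ * _).
    by rewrite big_split /= !prod_symbol symbol_conj.
  under eq_bigr => u _ do under eq_bigr => i _ do
    rewrite /entry_power /a /b !exprD -/(source_entry (u, i) t).
  rewrite (prodE (fun x => source_entry x t ^+ (x2 == x) * source_entry x t ^+ (x3 == x) *
    ((source_entry x t)^*%R ^+ (x1 == x) * (source_entry x t)^*%R ^+ (x4 == x)))).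
  rewrite !big_split /= !prod_expr_delta; ring.
rewrite -GF; split => //; rewrite [LHS]h2 mulrC prod_symbol_moment; congr (_ * _).
rewrite (prodE (fun x => if ((x2 == x) + (x3 == x) == (x1 == x) + (x4 == x))%N
    then (((x2 == x) + (x3 == x))`!)%:R else 0)).
exact: wick4.
Qed.

Lemma source_wick2 o o' x1 x2 :
  let F t := symbol_or_one o t * (symbol_or_one o' t)^*%R *
    ((source_entry x1 t)^*%R * source_entry x2 t) in
  cintegrable P F /\ E F = (o == o')%:R * (x1 == x2)%:R.
Proof.
pose a u i := (x2 == (u, i) : nat).
pose b u i := (x1 == (u, i) : nat).
have leb1 (p : bool) : (p <= 1)%N by case: p.
have leb2 (p : bool) : (p <= 2)%N by case: p.
have prodE (f : normal_source * 'I_M -> C) : \prod_u \prod_i f (u, i) = \prod_x f x.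
  by rewrite pair_bigA; apply: eq_bigr => -[].
move=> F.
have [h1 h2] := @source_moments a b (fun mn => o == Some mn) (fun mn => o' == Some mn)
  (fun u i => leb2 _) (fun u i => leb2 _) (fun mn => leb1 _) (fun mn => leb1 _).
move: h1; set G := (X in cintegrable P X) => h1; have GF : G = F.
  apply/funext => t; rewrite /G /F mulrC; congr (_ * _).
    by rewrite big_split /= !prod_symbol symbol_conj.
  rewrite (prodE (fun x => source_entry x t ^+ (x2 == x) *
    (source_entry x t)^*%R ^+ (x1 == x))).
  by rewrite big_split /= !prod_expr_delta mulrC.
rewrite -GF; split => //; rewrite [LHS]h2 mulrC prod_symbol_moment; congr (_ * _).
rewrite (prodE (fun x => if (x2 == x : nat) == (x1 == x)
    then ((x2 == x : nat)`!)%:R else 0)).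
exact: wick2.
Qed.

End SourceMoments.

(** * Second-order statistics of the matched filter *)

Section DeltaSums.
Context (V : comNzRingType) (I : finType).

Lemma sum_delta (f : I -> V) (x : I) : \sum_y f y * (x == y)%:R = f x.
Proof.
rewrite (bigD1 x) //= eqxx mulr1 big1 ?addr0 // => y yx.
by rewrite eq_sym (negbTE yx) mulr0.
Qed.

End DeltaSums.

Section WickSums.
Context (V : comNzRingType) (I : finType) (O : eqType) (M : nat) (o : I -> O).

(** [r] and [g] stand for the training and data coefficients of one filter, the primed ones for the
    other, and [o] for the carried symbol. In the crossed pairing [v = v'] already makes the symbols
    agree, so [o] is absent from the second term. *)
Lemma wick_sum (r g r' g' : I -> V) :
  \sum_(i < M) \sum_u \sum_v \sum_(i' < M) \sum_u' \sum_v'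
    r u * g v * (r' u' * g' v') * ((o v == o v')%:R *
     (((u, i) == (v, i))%:R * ((u', i') == (v', i'))%:R +
      ((u, i) == (u', i'))%:R * ((v, i) == (v', i'))%:R)) =
  M%:R ^+ 2 * (\sum_u \sum_u' r u * g u * (r' u' * g' u') * (o u == o u')%:R) +
  M%:R * ((\sum_u r u * r' u) * (\sum_v g v * g' v)).
Proof.
have first_term (i i' : 'I_M) u : \sum_v \sum_u' \sum_v'
    r u * g v * (r' u' * g' v') * ((o v == o v')%:R *
     (((u, i) == (v, i))%:R * ((u', i') == (v', i'))%:R)) =
    \sum_u' r u * g u * (r' u' * g' u') * (o u == o u')%:R.
  rewrite exchange_big /=; apply: eq_bigr => u' _.
  under eq_bigr => v _.
    under eq_bigr => v' _.
      rewrite !xpair_eqE !eqxx !andbT.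
      have -> : r u * g v * (r' u' * g' v') *
          ((o v == o v')%:R * ((u == v)%:R * (u' == v')%:R)) =
          (r u * g v * (r' u' * g' v') * (o v == o v')%:R * (u == v)%:R) *
          (u' == v')%:R by ring.
      over.
    rewrite sum_delta; over.
  by rewrite sum_delta.
have second_term (i : 'I_M) u v : \sum_(i' < M) \sum_u' \sum_v'
    r u * g v * (r' u' * g' v') * ((o v == o v')%:R *
     (((u, i) == (u', i'))%:R * ((v, i) == (v', i'))%:R)) =
    r u * g v * (r' u * g' v).
  have andE (x y w : bool) : (x && y)%:R * (w && y)%:R = x%:R * w%:R * y%:R :> V.
    by case: x y w => [] [] []; rewrite /= ?(mulr0, mul0r, mulr1).
  under eq_bigr => i' _.
    under eq_bigr => u' _.
      under eq_bigr => v' _.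
        rewrite !xpair_eqE andE.
        have -> : r u * g v * (r' u' * g' v') * ((o v == o v')%:R *
            ((u == u')%:R * (v == v')%:R * (i == i')%:R)) =
            (r u * g v * (r' u' * g' v') * (o v == o v')%:R *
              ((i == i')%:R * (u == u')%:R)) * (v == v')%:R by ring.
        over.
      rewrite sum_delta eqxx mulr1 mulrA; over.
    rewrite sum_delta; over.
  by rewrite sum_delta.
have splitE i u v : \sum_(i' < M) \sum_u' \sum_v'
    r u * g v * (r' u' * g' v') * ((o v == o v')%:R *
     (((u, i) == (v, i))%:R * ((u', i') == (v', i'))%:R +
      ((u, i) == (u', i'))%:R * ((v, i) == (v', i'))%:R)) =
    \sum_(i' < M) (\sum_u' \sum_v' r u * g v * (r' u' * g' v') *
      ((o v == o v')%:R * (((u, i) == (v, i))%:R * ((u', i') == (v', i'))%:R))) +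
    r u * g v * (r' u * g' v).
  rewrite -(second_term i) -big_split; apply: eq_bigr => i' _.
  rewrite -big_split; apply: eq_bigr => u' _.
  rewrite -big_split; apply: eq_bigr => v' _.
  by rewrite !mulrDr.
under eq_bigr => i _ do under eq_bigr => u _ do under eq_bigr => v _ do rewrite splitE.
under eq_bigr => i _ do under eq_bigr => u _ do
  rewrite big_split exchange_big /= (eq_bigr _ (fun i' _ => first_term i i' u))
    sumr_const card_ord.
under eq_bigr => i _ do rewrite big_split /= sumrMnl.
rewrite sumr_const card_ord mulrnDl -mulrnA -[_ *+ (M * M)]mulr_natl natrM expr2.
rewrite -[X in _ + X]mulr_natl; congr (_ + _ * _).
rewrite mulr_suml; apply: eq_bigr => u _; rewrite mulr_sumr.
by apply: eq_bigr => v _; ring.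
Qed.
End WickSums.

(** * Expansion of the matched filter and its second moments *)

Section MatchedFilter.
Context (d : measure_display) (T : measurableType d) (R : realType).
Variables (P : probability T R) (L K M : nat).
Variables (beta : 'I_L -> 'I_K -> 'I_L -> R) (p q : 'I_K -> 'I_L -> R).
Variables (h : 'I_L -> 'I_K -> 'I_L -> T -> 'cV[R[i]]_M)
          (zbar : 'I_K -> 'I_L -> T -> 'cV[R[i]]_M)
          (s : 'I_K -> 'I_L -> T -> R[i])
          (z : 'I_L -> T -> 'cV[R[i]]_M).
Hypotheses (hbeta : forall j k n, 0 < beta j k n)
  (hp : forall k n, 0 < p k n) (hq : forall k n, 0 < q k n).
Hypothesis model : uplink_model P h zbar s z.
Variable k : 'I_K.
Local Notation C := R[i].
Local Notation E := (cexpectation P).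
Local Notation normal_source := (normal_source L K).
Local Notation source_entry := (source_entry h zbar z).
Local Notation symbol_or_one := (symbol_or_one s).

(* Coefficients of the entries of all the normal sources in the training signal
   (for user k) and in the received signal of base station j. *)
Definition training_coef (j : 'I_L) (u : normal_source) : C :=
  match u with
  | inl (inl (j', m, n)) => if j' == j then
      (if m == k then (Num.sqrt (p m n) * Num.sqrt (beta j m n))%:C else 0) else 0
  | inl (inr (m, j')) => if m == k then (if j' == j then 1 else 0) else 0
  | inr _ => 0
  end.

Definition data_coef (j : 'I_L) (v : normal_source) : C :=
  match v with
  | inl (inl (j', m, n)) => if j' == j then
      (Num.sqrt (q m n) * Num.sqrt (beta j m n))%:C else 0
  | inl (inr _) => 0
  | inr j' => if j' == j then 1 else 0
  end.

(** For a data noise [None] means the constant 1; for a training noise it is a default value, always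
    met with the coefficient 0 of [data_coef]. *)
Definition carried_symbol (v : normal_source) : option ('I_K * 'I_L) :=
  if v is inl (inl (_, m, n)) then Some (m, n) else None.

Lemma sum_normal_source (f : normal_source -> C) : \sum_u f u =
  \sum_j \sum_m \sum_n f (inl (inl (j, m, n))) +
  \sum_m \sum_j f (inl (inr (m, j))) + \sum_j f (inr j).
Proof.
rewrite !big_sumType /=; congr (_ + _ + _).
  rewrite pair_bigA pair_bigA /=; apply: eq_bigr => -[[j m] n] _ //.
by rewrite pair_bigA /=; apply: eq_bigr => -[m j].
Qed.

Lemma sum_training_coef j (f : normal_source -> C) :
  \sum_u training_coef j u * f u =
  \sum_n (Num.sqrt (p k n) * Num.sqrt (beta j k n))%:C * f (inl (inl (j, k, n))) +
  f (inl (inr (k, j))).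
Proof.
rewrite sum_normal_source /= [X in _ + X]big1 ?addr0 => [|i _]; last by rewrite mul0r.
congr (_ + _).
  rewrite (bigD1 j) //= [X in _ + X]big1 ?addr0 => [|i ij]; last first.
    by rewrite big1 // => m _; rewrite big1 // => n _; rewrite (negbTE ij) mul0r.
  rewrite (bigD1 k) //= [X in _ + X]big1 ?addr0 => [|m mk]; last first.
    by rewrite big1 // => n _; rewrite eqxx (negbTE mk) mul0r.
  by apply: eq_bigr => n _; rewrite !eqxx.
rewrite (bigD1 k) //= [X in _ + X]big1 ?addr0 => [|m mk]; last first.
  by rewrite big1 // => n _; rewrite (negbTE mk) mul0r.
rewrite (bigD1 j) //= [X in _ + X]big1 ?addr0 => [|i ij]; last by rewrite eqxx (negbTE ij) mul0r.
by rewrite !eqxx mul1r.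
Qed.

Lemma sum_data_coef j (f : normal_source -> C) :
  \sum_v data_coef j v * f v =
  \sum_m \sum_n (Num.sqrt (q m n) * Num.sqrt (beta j m n))%:C *
    f (inl (inl (j, m, n))) + f (inr j).
Proof.
rewrite sum_normal_source /= [X in _ + X + _]big1 ?addr0 => [|i _]; last first.
  by rewrite big1 // => m _; rewrite mul0r.
congr (_ + _).
  rewrite (bigD1 j) //= [X in _ + X]big1 ?addr0 => [|i ij]; last first.
    by rewrite big1 // => m _; rewrite big1 // => n _; rewrite (negbTE ij) mul0r.
  by apply: eq_bigr => m _; apply: eq_bigr => n _; rewrite eqxx.
rewrite (bigD1 j) //= [X in _ + X]big1 ?addr0 => [|i ij]; last by rewrite (negbTE ij) mul0r.
by rewrite eqxx mul1r.
Qed.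

Let sqrtK (x y : R) : 0 < x -> 0 < y ->
  (Num.sqrt x * Num.sqrt y)%:C * (Num.sqrt x * Num.sqrt y)%:C = (y * x)%:C.
Proof.
move=> x0 y0; rewrite -rmorphM; congr (_%:C).
by rewrite mulrACA -!expr2 !sqr_sqrtr ?ltW // mulrC.
Qed.

(** Each channel vector or noise belongs to one base station, so distinct stations share no source.
    On the diagonal the squared coefficients add up to the first factor of [lambda]. *)
Lemma sum_training_training j j' :
  \sum_u training_coef j u * training_coef j' u =
  (j == j')%:R * (1 + \sum_n beta j k n * p k n)%:C.
Proof.
rewrite sum_training_coef /= eqxx; have [->|jj'] := eqVneq j j'.
  rewrite mul1r rmorphD rmorph1 addrC rmorph_sum; congr (_ + _).
  by apply: eq_bigr => n _; rewrite sqrtK.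
by rewrite addr0 mul0r big1 // => n _; rewrite mulr0.
Qed.

Lemma sum_data_data j j' :
  \sum_v data_coef j v * data_coef j' v =
  (j == j')%:R * (1 + \sum_n \sum_m beta j m n * q m n)%:C.
Proof.
rewrite sum_data_coef /=; have [->|jj'] := eqVneq j j'.
  rewrite mul1r rmorphD rmorph1 addrC exchange_big rmorph_sum; congr (_ + _).
  apply: eq_bigr => n _; rewrite rmorph_sum.
  by apply: eq_bigr => m _; rewrite sqrtK.
rewrite addr0 mul0r big1 // => m _; rewrite big1 // => n _; by rewrite mulr0.
Qed.

(** The sources common to training and data are the channels of user [k] in every cell, since these
    users share a pilot; both kinds of noise drop out. *)
Lemma sum_training_data j (f : normal_source -> C) :
  \sum_u training_coef j u * data_coef j u * f u =
  \sum_n (Num.sqrt (p k n) * Num.sqrt (q k n) * beta j k n)%:C *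
    f (inl (inl (j, k, n))).
Proof.
under eq_bigr => u _ do rewrite -mulrA.
rewrite sum_training_coef /= mul0r addr0; apply: eq_bigr => n _.
rewrite eqxx mulrA -rmorphM; congr (_%:C * _).
by rewrite mulrACA -expr2 sqr_sqrtr ?ltW // -mulrA.
Qed.

(** The channels to [j] and to [j'] are different sources, yet they carry the same symbol when the
    user is the same. Matching symbols identifies the cells n and n' but not the stations, whence
    the off-diagonal covariance. *)
Lemma sum_pilot_contamination j j' :
  \sum_u \sum_u' training_coef j u * data_coef j u *
    (training_coef j' u' * data_coef j' u') *
    (carried_symbol u == carried_symbol u')%:R =
  \sum_n (p k n * q k n * (beta j k n * beta j' k n))%:C.
Proof.
under eq_bigr => u _ do under eq_bigr => u' _ do rewrite -mulrA.
under eq_bigr => u _ do rewrite -mulr_sumr sum_training_data.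
rewrite sum_training_data; apply: eq_bigr => n _ /=.
under eq_bigr => n' _ do rewrite /= -[Some _ == _]/((k, n) == (k, n')) xpair_eqE eqxx /=.
rewrite sum_delta -rmorphM; congr (_%:C).
by rewrite mulrACA; congr (_ * _); rewrite mulrACA -!expr2 !sqr_sqrtr ?ltW.
Qed.

Let conj_real (x : R) : (x%:C)^*%R = x%:C :> C.
Proof. by rewrite conjcE /= oppr0. Qed.

Lemma training_coef_conj j u : (training_coef j u)^*%R = training_coef j u.
Proof.
case: u => [[[[j' m] n]|[m j']]|j'] /=; rewrite ?rmorph0 //.
  by case: ifP => _; rewrite ?rmorph0 //; case: ifP => _; rewrite ?rmorph0.
by case: ifP => _; rewrite ?rmorph0 //; case: ifP => _; rewrite ?rmorph0 ?rmorph1.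
Qed.

Lemma data_coef_conj j u : (data_coef j u)^*%R = data_coef j u.
Proof.
case: u => [[[[j' m] n]|[m j']]|j'] /=; rewrite ?rmorph0 //;
  by case: ifP => _; rewrite ?rmorph0 ?rmorph1.
Qed.

Lemma training_signalE j t i : training_signal beta p h zbar k j t i 0 =
  \sum_u training_coef j u * source_entry (u, i) t.
Proof.
rewrite sum_training_coef /training_signal !mxE summxE; congr (_ + _).
by apply: eq_bigr => n _; rewrite !mxE mulrA -rmorphM.
Qed.

Lemma receivedE j t i : received beta q h s z j t i 0 =
  \sum_v data_coef j v *
    (symbol_or_one (carried_symbol v) t * source_entry (v, i) t).
Proof.
rewrite sum_data_coef /received !mxE summxE /= mul1r; congr (_ + _).
rewrite exchange_big; apply: eq_bigr => n _; rewrite summxE.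
by apply: eq_bigr => m _; rewrite !mxE rmorphM mulrACA.
Qed.

(** An antenna, a source of the training signal and a source of the received signal: one monomial of
    the inner product. *)
Definition filter_index : Type := ('I_M * normal_source * normal_source)%type.
HB.instance Definition _ := Finite.on filter_index.

Definition filter_term (w : filter_index) (t : T) : C :=
  symbol_or_one (carried_symbol w.2) t *
  ((source_entry (w.1.2, w.1.1) t)^*%R * source_entry (w.2, w.1.1) t).

Definition filter_coef j (w : filter_index) : C :=
  training_coef j w.1.2 * data_coef j w.2.

Lemma sum_filter_index (f : filter_index -> C) :
  \sum_w f w = \sum_(i < M) \sum_u \sum_v f (i, u, v).
Proof.
by rewrite pair_bigA pair_bigA /=; apply: eq_bigr => -[[i u] v].
Qed.

Lemma matched_filterE j t : matched_filter beta p q h zbar s z k j t =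
  (Defs.eta beta p k j)%:C * \sum_w filter_coef j w * filter_term w t.
Proof.
have adjE (A : 'cV[C]_M) i : (A^t*) 0 i = (A i 0)^*%R by rewrite !mxE.
have estE i : channel_estimate beta p h zbar j k t i 0 =
    (Defs.eta beta p k j)%:C * training_signal beta p h zbar k j t i 0.
  by rewrite mxE.
rewrite sum_filter_index /matched_filter mxE mulr_sumr; apply: eq_bigr => i _.
rewrite adjE estE rmorphM /= conj_real -mulrA.
congr (_ * _); rewrite training_signalE receivedE rmorph_sum mulr_suml.
apply: eq_bigr => u _; rewrite mulr_sumr; apply: eq_bigr => v _.
by rewrite rmorphM /= training_coef_conj /filter_coef /filter_term /=; ring.
Qed.

Lemma filter_term_cross m n w :
  cintegrable P (fun t => (s m n t)^*%R * filter_term w t) /\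
  E (fun t => (s m n t)^*%R * filter_term w t) =
    (carried_symbol w.2 == Some (m, n))%:R * (w.1.2 == w.2)%:R.
Proof.
have [h1 h2] := source_wick2 model (carried_symbol w.2) (Some (m, n))
  (w.1.2, w.1.1) (w.2, w.1.1).
have fE : (fun t => (s m n t)^*%R * filter_term w t) =
    (fun t => symbol_or_one (carried_symbol w.2) t *
      (symbol_or_one (Some (m, n)) t)^*%R *
      ((source_entry (w.1.2, w.1.1) t)^*%R * source_entry (w.2, w.1.1) t)).
  by apply/funext => t; rewrite /filter_term mulrCA mulrA.
by rewrite fE; split => //; rewrite [LHS]h2 xpair_eqE eqxx andbT.
Qed.

Lemma filter_term_product w w' :
  cintegrable P (fun t => filter_term w t * (filter_term w' t)^*%R) /\
  E (fun t => filter_term w t * (filter_term w' t)^*%R) =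
    (carried_symbol w.2 == carried_symbol w'.2)%:R *
    (((w.1.2, w.1.1) == (w.2, w.1.1))%:R * ((w'.1.2, w'.1.1) == (w'.2, w'.1.1))%:R +
     ((w.1.2, w.1.1) == (w'.1.2, w'.1.1))%:R * ((w.2, w.1.1) == (w'.2, w'.1.1))%:R).
Proof.
have [h1 h2] := source_wick4 model (carried_symbol w.2) (carried_symbol w'.2)
  (w.1.2, w.1.1) (w.2, w.1.1) (w'.1.2, w'.1.1) (w'.2, w'.1.1).
have fE : (fun t => filter_term w t * (filter_term w' t)^*%R) =
    (fun t => symbol_or_one (carried_symbol w.2) t *
      (symbol_or_one (carried_symbol w'.2) t)^*%R *
      ((source_entry (w.1.2, w.1.1) t)^*%R * source_entry (w.2, w.1.1) t *
       (source_entry (w'.1.2, w'.1.1) t * (source_entry (w'.2, w'.1.1) t)^*%R))).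
  apply/funext => t; rewrite /filter_term !rmorphM /= conjCK; ring.
by rewrite fE; split.
Qed.

(** Only a source common to the estimate and the data and carrying [s k l] survives, namely the
    channel of user [k] of cell [l]. Each of the M antennas contributes equally. *)
Lemma matched_filter_cross j l :
  E (fun t => (s k l t)^*%R * matched_filter beta p q h zbar s z k j t) =
  (Defs.eta beta p k j)%:C * M%:R *
    (Num.sqrt (p k l) * Num.sqrt (q k l) * beta j k l)%:C.
Proof.
have -> : (fun t => (s k l t)^*%R * matched_filter beta p q h zbar s z k j t) =
    (fun t => (Defs.eta beta p k j)%:C *
      \sum_w filter_coef j w * ((s k l t)^*%R * filter_term w t)).
  apply/funext => t; rewrite matched_filterE mulrCA; congr (_ * _).
  by rewrite mulr_sumr; apply: eq_bigr => w _; rewrite mulrCA.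
have ci w : cintegrable P (fun t => filter_coef j w * ((s k l t)^*%R * filter_term w t)).
  by apply: cintegrableZ; case: (filter_term_cross k l w).
rewrite cexpectationZ; last by apply: cintegrable_sum.
rewrite cexpectation_sum // -mulrA; congr (_ * _).
under eq_bigr => w _.
  rewrite cexpectationZ; last by case: (filter_term_cross k l w).
  rewrite (filter_term_cross k l w).2; over.
rewrite sum_filter_index /= /filter_coef /=.
under eq_bigr => i _ do under eq_bigr => u _ do under eq_bigr => v _ do rewrite mulrA.
under eq_bigr => i _ do under eq_bigr => u _ do rewrite sum_delta.
under eq_bigr => i _ do rewrite sum_training_data.
rewrite sumr_const card_ord mulr_natl; congr (_ *+ _).
rewrite (bigD1 l) //= eqxx mulr1 big1 ?addr0 // => n nl.
by rewrite -[Some _ == _]/((k, n) == (k, l)) xpair_eqE eqxx (negbTE nl) mulr0.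
Qed.

Lemma matched_filter_covariance j j' :
  E (fun t => matched_filter beta p q h zbar s z k j t *
    (matched_filter beta p q h zbar s z k j' t)^*%R) =
  (Defs.eta beta p k j)%:C * (Defs.eta beta p k j')%:C *
  (M%:R ^+ 2 * (\sum_n (p k n * q k n * (beta j k n * beta j' k n))%:C) +
   M%:R * ((j == j')%:R * (lambda beta p q j k)%:C)).
Proof.
have -> : (fun t => matched_filter beta p q h zbar s z k j t *
      (matched_filter beta p q h zbar s z k j' t)^*%R) =
    (fun t => (Defs.eta beta p k j)%:C * (Defs.eta beta p k j')%:C *
      \sum_w \sum_w' filter_coef j w * filter_coef j' w' *
        (filter_term w t * (filter_term w' t)^*%R)).
  apply/funext => t; rewrite !matched_filterE [X in _ * X]rmorphM /= conj_real mulrACA.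
  congr (_ * _); rewrite rmorph_sum mulr_suml; apply: eq_bigr => w _.
  rewrite mulr_sumr; apply: eq_bigr => w' _.
  by rewrite !rmorphM /= training_coef_conj data_coef_conj /filter_coef mulrACA.
have ci w w' : cintegrable P (fun t => filter_coef j w * filter_coef j' w' *
    (filter_term w t * (filter_term w' t)^*%R)).
  by apply: cintegrableZ; case: (filter_term_product w w').
have ci' w : cintegrable P (fun t => \sum_w' filter_coef j w * filter_coef j' w' *
    (filter_term w t * (filter_term w' t)^*%R)) by apply: cintegrable_sum.
rewrite cexpectationZ; last by apply: cintegrable_sum.
rewrite cexpectation_sum //; congr (_ * _).
under eq_bigr => w _.
  rewrite cexpectation_sum //.
  under eq_bigr => w' _.
    rewrite cexpectationZ; last by case: (filter_term_product w w').
    rewrite (filter_term_product w w').2; over.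
  rewrite sum_filter_index; over.
rewrite sum_filter_index /= /filter_coef /= wick_sum sum_pilot_contamination.
(* Training and received energies each bring a factor [j == j']; the two merge into one. *)
rewrite sum_training_training sum_data_data /lambda rmorphM mulrACA -natrM mulnb andbb.
by [].
Qed.

End MatchedFilter.

(** * The optimal combining vector *)

Section PositiveDefinite.
Context (R : realType).
Local Notation C := R[i].

Lemma normc_sqr (x : C) : (Normc.normc x ^+ 2)%:C = x * x^*%R.
Proof.
rewrite conjcE; case: x => a b /=; rewrite sqr_sqrtr ?addr_ge0 ?sqr_ge0 //.
by apply/eqP; rewrite eq_complex ReM ImM /=; apply/andP; split; apply/eqP; ring.
Qed.

Lemma normc_conj (x : C) : Normc.normc x^*%R = Normc.normc x.
Proof. by rewrite conjcE; case: x => a b /=; rewrite sqrrN. Qed.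

Lemma normc_gt0 (x : C) : x != 0 -> 0 < Normc.normc x.
Proof.
move=> x0; rewrite lt_def; apply/andP; split.
  by apply: contra_neq x0; exact: Normc.eq0_normc.
by case: x {x0} => a b; rewrite /= sqrtr_ge0.
Qed.

Lemma adjmxM m n o (A : 'M[C]_(m, n)) (B : 'M[C]_(n, o)) :
  (A *m B)^t* = B^t* *m A^t*.
Proof. by rewrite trmx_mul map_mxM. Qed.

Lemma adjmxZ m n (c : C) (A : 'M[C]_(m, n)) : (c *: A)^t* = c^*%R *: A^t*.
Proof. by apply/matrixP => i j; rewrite !mxE rmorphM. Qed.

Lemma adjmxD m n (A B : 'M[C]_(m, n)) : (A + B)^t* = A^t* + B^t*.
Proof. by apply/matrixP => i j; rewrite !mxE rmorphD. Qed.

Lemma adjmxK m n (A : 'M[C]_(m, n)) : (A^t*)^t* = A.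
Proof. by apply/matrixP => i j; rewrite !mxE conjCK. Qed.

Context (n : nat).

(** The quadratic form is recorded as a real function [Q], so that comparisons and quotients take
    place in [R] rather than in [R[i]]. *)
Definition positive_definite (A : 'M[C]_n) (Q : 'cV[C]_n -> R) : Prop :=
  [/\ A^t* = A, forall v : 'cV_n, (v^t* *m A *m v) 0 0 = (Q v)%:C &
      forall v, v != 0 -> 0 < Q v].

Lemma positive_definite_unitmx A Q : positive_definite A Q -> A \in unitmx.
Proof.
move=> [_ qE Qpos]; rewrite -row_free_unit; apply: inj_row_free => v vA.
apply/eqP; apply: contraT => v0.
have w0 : v^t* != 0.
  by apply: contra_neq v0 => /(congr1 (fun w => w^t*)); rewrite adjmxK => ->;
    apply/matrixP => i j; rewrite !mxE rmorph0.
have := qE (v^t*); rewrite adjmxK vA mul0mx mxE => /(congr1 (@complex.Re R)) /= Q0.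
by have := Qpos _ w0; rewrite -Q0 ltxx.
Qed.

Lemma positive_definite_cauchy_schwarz A Q (v x : 'cV[C]_n) :
  positive_definite A Q -> x != 0 ->
  Normc.normc ((v^t* *m A *m x) 0 0) ^+ 2 <= Q v * Q x.
Proof.
move=> [hA qE Qpos] x0.
pose f (u w : 'cV[C]_n) : C := (u^t* *m A *m w) 0 0.
have fDl u u' w : f (u + u') w = f u w + f u' w.
  by rewrite /f adjmxD !mulmxDl mxE.
have fDr u w w' : f u (w + w') = f u w + f u w'.
  by rewrite /f mulmxDr mxE.
have fZl c u w : f (c *: u) w = c^*%R * f u w.
  by rewrite /f adjmxZ -!scalemxAl mxE.
have fZr c u w : f u (c *: w) = c * f u w.
  by rewrite /f -scalemxAr mxE.
have fC u w : f w u = (f u w)^*%R.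
  rewrite /f -[w^t* *m A *m u]adjmxK mxE mxE !adjmxM adjmxK hA mulmxA.
  by [].
have r0 := Qpos _ x0.
have Q_ge0 w : 0 <= Q w.
  have [->|w0] := eqVneq w 0; last exact/ltW/Qpos.
  by have := qE 0; rewrite mulmx0 mxE => /(congr1 (@complex.Re R)) /= <-.
have rconj : (Q x)%:C^*%R = (Q x)%:C :> C by rewrite conjcE /= oppr0.
(* This is [v] minus its projection onto [x], scaled by [Q x] to avoid a division. Its form equals Q
   x (Q v Q x - |f x v|^2). *)
have := Q_ge0 ((Q x)%:C *: v + (- f x v) *: x).
have fQ w : f w w = (Q w)%:C by rewrite /f qE.
rewrite -lecR -[(Q (_ + _))%:C]fQ fDl !fDr !fZl !fZr rmorphN rconj !fQ.
rewrite (fC x v).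
have -> : (Q x)%:C * ((Q x)%:C * (Q v)%:C) + (Q x)%:C * (- f x v * (f x v)^*%R) +
    (- (f x v)^*%R * ((Q x)%:C * f x v) + - (f x v)^*%R * (- f x v * (Q x)%:C)) =
    (Q x)%:C * ((Q v)%:C * (Q x)%:C - f x v * (f x v)^*%R) by ring.
rewrite -normc_sqr -!rmorphM -rmorphB -rmorphM lecR pmulr_rge0 // subr_ge0.
by rewrite -/(f v x) (fC x v) normc_conj.
Qed.

End PositiveDefinite.

(** * Matrix form of the covariance, the correlation and the SINR *)

Section Optimality.
Context (d : measure_display) (T : measurableType d) (R : realType)
    (P : probability T R) (L K M : nat)
    (beta : 'I_L -> 'I_K -> 'I_L -> R) (p q : 'I_K -> 'I_L -> R)
    (h : 'I_L -> 'I_K -> 'I_L -> T -> 'cV[R[i]]_M)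
    (zbar : 'I_K -> 'I_L -> T -> 'cV[R[i]]_M)
    (s : 'I_K -> 'I_L -> T -> R[i])
    (z : 'I_L -> T -> 'cV[R[i]]_M).
Hypotheses (hM : (0 < M)%N)
    (hbeta : forall j k n, 0 < beta j k n)
    (hp : forall k n, 0 < p k n) (hq : forall k n, 0 < q k n)
    (hmodel : uplink_model P h zbar s z).
Variables (k : 'I_K) (l : 'I_L) (Omega : {set 'I_L}).
Local Notation C := R[i].
Local Notation N := #|Omega|.
Local Notation b := (beta_vector beta Omega k).
Local Notation D := (D_mx beta p Omega k).
Local Notation weight n := (p k n * q k n * M%:R).

Lemma lambda_gt0 j : 0 < lambda beta p q j k.
Proof.
rewrite /lambda mulr_gt0 // ltr_pwDl // sumr_ge0 // => n _.
  by rewrite mulr_ge0 ?ltW.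
by rewrite sumr_ge0 // => m _; rewrite mulr_ge0 ?ltW.
Qed.

Lemma eta_gt0 j : 0 < Defs.eta beta p k j.
Proof.
rewrite /Defs.eta divr_gt0 ?mulr_gt0 ?sqrtr_gt0 // ltr_pwDl // sumr_ge0 // => n _.
by rewrite mulr_ge0 ?ltW.
Qed.

Lemma D_mx_unit : D \in unitmx.
Proof.
rewrite unitmxE det_diag unitfE; apply/prodf_neq0 => i _; rewrite mxE.
by rewrite -[0]/(0%:C) (inj_eq (@complexI R)) gt_eqF // eta_gt0.
Qed.

(** Common form of two matrices: excluding n = l gives [interference_mx], while all n give the
    covariance of the filter outputs up to [D] and a factor M. *)
Definition gram_mx (S : pred 'I_L) : 'M[C]_N :=
  \sum_(n | S n) (weight n)%:C *: (b n *m (b n)^t*) + Lambda_mx beta p q Omega k.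

Definition gram_form (S : pred 'I_L) (v : 'cV[C]_N) : R :=
  \sum_(n | S n) weight n * Normc.normc ((v^t* *m b n) 0 0) ^+ 2 +
  \sum_i Normc.normc (v i 0) ^+ 2 * lambda beta p q (enum_val i) k.

Lemma gram_mxE S i j : gram_mx S i j =
  (\sum_(n | S n) weight n * (beta (enum_val i) k n * beta (enum_val j) k n) +
   lambda beta p q (enum_val i) k *+ (i == j))%:C.
Proof.
rewrite rmorphD rmorphMn rmorph_sum /gram_mx !mxE summxE; congr (_ + _).
apply: eq_bigr => n _; rewrite !mxE big_ord1 !mxE !rmorphM conjcE /= oppr0.
by [].
Qed.

(** The rank-one terms are only nonnegative; definiteness comes from the positive diagonal [lambda],
    whatever [S]. *)
Lemma gram_mx_positive_definite S : positive_definite (gram_mx S) (gram_form S).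
Proof.
split=> [|v|v v0].
- apply/matrixP => i j; rewrite mxE mxE !gram_mxE conjcE /= oppr0; congr (_%:C).
  rewrite eq_sym; congr (_ + _); last by have [->|] := eqVneq i j.
  by apply: eq_bigr => n _; rewrite [beta (enum_val j) k n * _]mulrC.
- rewrite /gram_mx mulmxDr mulmx_sumr mulmxDl mulmx_suml mxE summxE.
  rewrite /gram_form rmorphD !rmorph_sum; congr (_ + _).
    apply: eq_bigr => n _; rewrite [RHS]rmorphM /= normc_sqr -scalemxAr -scalemxAl mxE.
    congr (_ * _); transitivity (((v^t* *m b n) *m ((b n)^t* *m v)) 0 0).
      by rewrite !mulmxA.
    rewrite mxE big_ord1; congr (_ * _).
    by rewrite -[(b n)^t* *m v]adjmxK mxE mxE adjmxM adjmxK.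
  rewrite mxE; apply: eq_bigr => i _; rewrite mul_mx_diag !mxE [RHS]rmorphM /= normc_sqr.
  by rewrite mulrAC [_^*%R * _]mulrC.
- have wn n : 0 <= weight n by rewrite !mulr_ge0 ?ler0n ?ltW.
  have [i vi] : exists i, v i 0 != 0.
    apply/existsP; apply: contraR v0; rewrite negb_exists => /forallP v0.
    by apply/eqP/matrixP => i j; rewrite ord1 mxE; apply/eqP/negbNE/v0.
  rewrite ltr_wpDl ?sumr_ge0 // => [n _|]; first by rewrite mulr_ge0 ?sqr_ge0.
  rewrite (bigD1 i) //= ltr_pwDl ?sumr_ge0 // => [|j _].
    by rewrite mulr_gt0 ?lambda_gt0 // exprn_gt0 // normc_gt0.
  by rewrite mulr_ge0 ?sqr_ge0 // ltW // lambda_gt0.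
Qed.

(** Of the factor M^2 in the contamination term, one M enters the weight and the other is shared
    with the diagonal term. *)
Lemma mf_covarianceE :
  mf_covariance P beta p q h zbar s z Omega k =
  M%:R *: (D *m gram_mx predT *m D).
Proof.
apply/matrixP => i j; rewrite mxE [RHS]mxE mul_mx_diag mxE mul_diag_mx mxE mxE gram_mxE.
transitivity (cexpectation P (fun t =>
    matched_filter beta p q h zbar s z k (enum_val i) t *
    (matched_filter beta p q h zbar s z k (enum_val j) t)^*%R)).
  by congr (cexpectation P _); apply/funext => t; rewrite mxE big_ord1 !mxE.
rewrite matched_filter_covariance // mxE (inj_eq enum_val_inj).
rewrite rmorphD rmorphMn rmorph_sum -[_ *+ (i == j)]mulr_natl.
have -> : \sum_n (weight n * (beta (enum_val i) k n * beta (enum_val j) k n))%:C =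
    M%:R * \sum_n (p k n * q k n * (beta (enum_val i) k n * beta (enum_val j) k n))%:C :> C.
  rewrite mulr_sumr; apply: eq_bigr => n _.
  by rewrite -[M%:R in RHS](rmorph_nat (real_complex R)) -rmorphM; congr (_%:C); ring.
by ring.
Qed.

Lemma mf_crossE :
  mxexpectation P (fun t => (s k l t)^*%R *:
    mf_vector beta p q h zbar s z Omega k t) =
  (M%:R * (Num.sqrt (p k l) * Num.sqrt (q k l))%:C) *: (D *m b l).
Proof.
apply/matrixP => i j; rewrite ord1 mxE [RHS]mxE mul_diag_mx !mxE.
transitivity (cexpectation P (fun t => (s k l t)^*%R *
    matched_filter beta p q h zbar s z k (enum_val i) t)).
  congr (cexpectation P _); apply/funext => t.
  by rewrite mxE [X in _ * X]mxE.
by rewrite matched_filter_cross // rmorphM; ring.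
Qed.

Lemma SINR_decE (a : 'cV[C]_N) : SINR_dec M beta p q k l a =
  weight l * Normc.normc (((D *m a)^t* *m b l) 0 0) ^+ 2 /
  gram_form [pred n | n != l] (D *m a).
Proof.
have De i : (D *m a) i 0 = (Defs.eta beta p k (enum_val i))%:C * a i 0.
  by rewrite mul_diag_mx !mxE.
have gainE n : \sum_i ((Defs.eta beta p k (enum_val i))%:C * a i 0)^*%R *
    (beta (enum_val i) k n)%:C = ((D *m a)^t* *m b n) 0 0.
  by rewrite [RHS]mxE; apply: eq_bigr => i _; rewrite 2!mxE De mxE.
rewrite /SINR_dec /gram_form gainE; congr (_ * _ / (_ + _)).
- ring.
- rewrite mulr_sumr; apply: eq_bigr => n _; rewrite gainE; ring.
- by apply: eq_bigr => i _; rewrite De.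
Qed.

(** Membership of [l] in [Omega] provides an index, and the entry there is positive. *)
Lemma beta_vector_neq0 (hl : l \in Omega) : b l != 0.
Proof.
apply/eqP => /matrixP /(_ (enum_rank_in hl l) 0); rewrite !mxE => /eqP.
by rewrite -[0]/(0%:C) (inj_eq (@complexI R)) gt_eqF.
Qed.

End Optimality.

(** [invmx] returns its argument on a singular matrix, so the invertibility claims are what make the
    inverses in the other conjuncts genuine. *)
Theorem theorem6 (d : measure_display) (T : measurableType d) (R : realType)
    (P : probability T R) (L K M : nat)
    (beta : 'I_L -> 'I_K -> 'I_L -> R) (p q : 'I_K -> 'I_L -> R)
    (h : 'I_L -> 'I_K -> 'I_L -> T -> 'cV[R[i]]_M)
    (zbar : 'I_K -> 'I_L -> T -> 'cV[R[i]]_M)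
    (s : 'I_K -> 'I_L -> T -> R[i])
    (z : 'I_L -> T -> 'cV[R[i]]_M)
    (hM : (0 < M)%N)
    (hbeta : forall j k n, 0 < beta j k n)
    (hp : forall k n, 0 < p k n) (hq : forall k n, 0 < q k n)
    (hmodel : uplink_model P h zbar s z)
    (k : 'I_K) (l : 'I_L) (Omega : {set 'I_L}) (hl : l \in Omega) :
  let a := a_MMSE P beta p q h zbar s z Omega k l in
  let A := interference_mx M beta p q Omega k l in
  let b := beta_vector beta Omega k l in
  [/\ mf_covariance P beta p q h zbar s z Omega k \in unitmx,
      A \in unitmx & D_mx beta p Omega k \in unitmx] /\
  (exists c : R[i], c != 0 /\
     a = c *: (invmx (D_mx beta p Omega k) *m
               ahat_opt M beta p q Omega k l)) /\
  (a != 0 /\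
   forall a' : 'cV[R[i]]_#|Omega|, a' != 0 ->
     SINR_dec M beta p q k l a' <= SINR_dec M beta p q k l a) /\
  (SINR_dec M beta p q k l a)%:C =
    (p k l * q k l * M%:R)%:C * (b^t* *m invmx A *m b) 0 0.
Proof.
move=> a A b.
pose D := D_mx beta p Omega k.
pose Q := gram_form M beta p q k (Omega := Omega) [pred n | n != l].
pose w := p k l * q k l * M%:R.
pose Cov := mf_covariance P beta p q h zbar s z Omega k.
have w0 : 0 < w by rewrite !mulr_gt0 ?ltr0n.
have Apd : positive_definite A Q.
  exact: gram_mx_positive_definite hbeta hp hq k Omega [pred n | n != l].
have Aunit := positive_definite_unitmx Apd.
have [Aherm AQ Qpos] := Apd.
pose B := gram_mx M beta p q k Omega predT.
have Bunit : B \in unitmx.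
  apply: positive_definite_unitmx.
  exact: gram_mx_positive_definite hbeta hp hq k Omega predT.
have Dunit : D \in unitmx by exact: D_mx_unit.
have b0 : b != 0 by exact: beta_vector_neq0.
have M0 : (M%:R : R[i]) != 0 by rewrite pnatr_eq0 -lt0n.
have CovE : Cov = M%:R *: (D *m B *m D) by exact: mf_covarianceE.
have Covunit : Cov \in unitmx.
  by rewrite CovE unitmxZ ?unitfE // !unitmx_mul Dunit Bunit.
pose x := invmx A *m b.
have Ax : A *m x = b by rewrite /x mulKVmx.
have x0 : x != 0 by apply: contra_neq b0 => x0; rewrite -Ax x0 mulmx0.
have Qx := Qpos _ x0.
have bE : b^t* = x^t* *m A by rewrite -Ax adjmxM Aherm.
have bx : (b^t* *m x) 0 0 = (Q x)%:C by rewrite bE AQ.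
have BE : B = A + w%:C *: (b *m b^t*).
  by rewrite /B /gram_mx (bigD1 l) //= -addrA addrC.
(* As b^H x = Q x, the rank-one term sends [x] to w Q x times [b]. *)
have Bx : B *m x = (1 + w * Q x)%:C *: b.
  rewrite BE mulmxDl Ax -scalemxAl -mulmxA [b^t* *m x]mx11_scalar bx.
  rewrite mul_mx_scalar scalerA [X in _ = X *: _]rmorphD rmorph1 scalerDl scale1r.
  by rewrite [X in _ = _ + X *: _]rmorphM.
have t0 : 0 < 1 + w * Q x by rewrite ltr_pwDl // mulr_ge0 // ltW.
(* [Cov] sends c D^-1 x to M c (1 + w Q x) D b, which has to equal the correlation M sqrt(p q) D b;
   the factors M cancel. *)
pose c : R[i] := (Num.sqrt (p k l) * Num.sqrt (q k l) / (1 + w * Q x))%:C.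
have c0 : c != 0.
  rewrite -[0]/(0%:C) (inj_eq (@complexI R)) gt_eqF // divr_gt0 //.
  by rewrite mulr_gt0 ?sqrtr_gt0.
have aE : a = c *: (invmx D *m x).
  rewrite /a /a_MMSE mf_crossE // -/Cov -/D -/b.
  suff -> : (M%:R * (Num.sqrt (p k l) * Num.sqrt (q k l))%:C) *: (D *m b) =
      Cov *m (c *: (invmx D *m x)) by rewrite mulKmx.
  rewrite CovE -scalemxAl -scalemxAr scalerA -!mulmxA mulKVmx // Bx.
  rewrite -scalemxAr scalerA -mulrA -rmorphM; congr (_ * _%:C *: _).
  by rewrite divfK // gt_eqF.
clearbody c.
have Da : D *m a = c *: x by rewrite aE -scalemxAr mulKVmx.
have a0 : a != 0.
  by apply: contra_neq x0 => a0; move: Da; rewrite a0 mulmx0 => /esym/eqP;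
    rewrite scaler_eq0 (negbTE c0) => /eqP.
have SINR_a' (a' : 'cV_#|Omega|) : a' != 0 ->
    SINR_dec M beta p q k l a' <= w * Q x.
  move=> a'0; have v0 : D *m a' != 0.
    by apply: contra_neq a'0 => v0; rewrite -[a'](mulKmx Dunit) v0 mulmx0.
  rewrite SINR_decE -/D -/b -/w -/Q ler_pdivrMr ?Qpos // -[leRHS]mulrA ler_pM2l //.
  (* Writing [b] as A x turns v^H b into the inner product of [v] and [x] for A. *)
  rewrite -[X in _ *m X]Ax mulmxA mulrC.
  exact: positive_definite_cauchy_schwarz.
have SINR_a : SINR_dec M beta p q k l a = w * Q x.
  rewrite SINR_decE -/D -/b -/w -/Q Da.
  (* Numerator and denominator both scale by |c|^2, so the value does not depend on [c]. *)
  have QZ : Q (c *: x) = Normc.normc c ^+ 2 * Q x.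
    apply: (@complexI R); rewrite -AQ [RHS]rmorphM /= normc_sqr -AQ adjmxZ.
    by rewrite -!scalemxAl -scalemxAr scalerA mxE [_^*%R * _]mulrC.
  have xb : ((c *: x)^t* *m b) 0 0 = c^*%R * (Q x)%:C.
    by rewrite adjmxZ -scalemxAl mxE -Ax mulmxA AQ.
  rewrite QZ xb Normc.normcM normc_conj /= expr0n /= addr0 sqrtr_sqr.
  rewrite (ger0_norm (ltW Qx)); field.
  by rewrite !gt_eqF //= normc_gt0.
split; first by split.
split; first by exists c.
split; first by split=> // a' /SINR_a'; rewrite SINR_a.
by rewrite SINR_a -mulmxA -/x bx -rmorphM.
Qed.
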